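(* Let $U$ be a complete length $\mathrm{CAT}(\kappa)$ space and let $\{f_t\}$ be a family of functions defined on an open set $\Omega=\{(x,t)\in U\times\mathbb{R}: x\in\mathrm{Dom}f_t\}$. Suppose the family is Lipschitz and locally semiconcave. Then for every time $a$ and every initial point $p\in\mathrm{Dom}f_a$ there is a unique $f_t$-gradient curve $\alpha$ with $\alpha(a)=p$ defined on a maximal semi-open interval $[a,b)$, $b\in(a,\infty]$. Moreover, if $b<\infty$, then $(\alpha(t),t)$ escapes from every closed set $K\subset\Omega$, i.e. for every closed $K\subset\Omega$ there is $t_0<b$ with $(\alpha(t),t)\notin K$ for all $t\in(t_0,b)$.
   Context: A family $f_t$ is Lipschitz if $(x,t)\mapsto f_t(x)$ is $L$-Lipschitz on $\Omega$ for some $L$. It is locally semiconcave if every $(p_0,t_0)\in\Omega$ has a neighborhood $\Omega'$ and $\lambda\in\mathbb{R}$ such that each $f_t$ restricted to $\Omega'$ is $\lambda$-concave, where $\lambda$-concave means $s\mapsto f(\sigma(s))-\tfrac\lambda2 s^2$ is concave along every unit-speed geodesic $\sigma$ in the domain. $T_q$ denotes the tangent cone at $q$, $\uparrow_q^p\in T_q$ the unit direction of a geodesic $[qp]$, and $d_qf(\uparrow_q^p)$ the right derivative at $0$ of $f$ along the unit-speed geodesic from $q$ to $p$. A Lipschitz curve $\alpha$ is an $f_t$-gradient curve if for every point $p$ and time $t$ for which a geodesic $[\alpha(t)\,p]$ exists, $|p-\alpha(t+\epsilon)|\le|p-\alpha(t)|-\epsilon\cdot d_{\alpha(t)}f_t(\uparrow_{\alpha(t)}^p)+o(\epsilon)$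 as $\epsilon\to0^+$. *)

(* Defs.v *)
From Stdlib Require Import Reals Lra.
Open Scope R_scope.

Record is_metric {X : Type} (d : X -> X -> R) : Prop := {
  d_nonneg : forall x y, 0 <= d x y;
  d_eq0 : forall x y, d x y = 0 <-> x = y;
  d_sym : forall x y, d x y = d y x;
  d_tri : forall x y z, d x z <= d x y + d y z }.

Definition complete {X : Type} (d : X -> X -> R) : Prop :=
  forall u : nat -> X,
    (forall e, 0 < e -> exists N, forall m n, (N <= m)%nat -> (N <= n)%nat ->
        d (u m) (u n) < e) ->
    exists l, forall e, 0 < e -> exists N, forall n, (N <= n)%nat -> d (u n) l < e.

Definition continuous_on {X : Type} (d : X -> X -> R) (c : R -> X) (lo hi : R) : Prop :=
  forall t, lo <= t <= hi -> forall e, 0 < e -> exists delta, 0 < delta /\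
    forall s, lo <= s <= hi -> Rabs (s - t) < delta -> d (c s) (c t) < e.

Fixpoint psum {X : Type} (d : X -> X -> R) (c : R -> X) (tau : nat -> R) (n : nat) : R :=
  match n with
  | O => 0
  | S k => psum d c tau k + d (c (tau k)) (c (tau (S k)))
  end.

Definition partition01 (tau : nat -> R) (n : nat) : Prop :=
  tau O = 0 /\ tau n = 1 /\ (forall i, (i < n)%nat -> tau i <= tau (S i)).

Definition length_le {X : Type} (d : X -> X -> R) (c : R -> X) (M : R) : Prop :=
  forall n tau, partition01 tau n -> psum d c tau n <= M.

Definition length_space {X : Type} (d : X -> X -> R) : Prop :=
  forall x y e, 0 < e -> exists c : R -> X,
    continuous_on d c 0 1 /\ c 0 = x /\ c 1 = y /\ length_le d c (d x y + e).

Definition unit_geodesic_on {X : Type} (d : X -> X -> R) (sigma : R -> X) (lo hi : R) : Prop :=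
  forall u v, lo <= u <= hi -> lo <= v <= hi -> d (sigma u) (sigma v) = Rabs (u - v).

Definition geodesic_between {X : Type} (d : X -> X -> R) (sigma : R -> X) (x y : X) : Prop :=
  unit_geodesic_on d sigma 0 (d x y) /\ sigma 0 = x /\ sigma (d x y) = y.

(* Comparison with the model plane M_kappa: in a triangle of M_kappa with side
   lengths |xy| = a > 0, |px| = b, |py| = c, the point z on [xy] with |xz| = s
   satisfies |pz| = Dt where
     kappa > 0, k = sqrt kappa:
        cos(k Dt) sin(k a) = cos(k b) sin(k (a-s)) + cos(k c) sin(k s)
     kappa = 0:
        Dt^2 a = b^2 (a-s) + c^2 s - s (a-s) a          (Stewart)
     kappa < 0, k = sqrt(-kappa):
        cosh(k Dt) sinh(k a) = cosh(k b) sinh(k (a-s)) + cosh(k c) sinh(k s)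
   (obtained by eliminating the angle at x from the model law of cosines).
   [cat_comparison kappa a b c s D] says D <= Dt, written through the
   monotone functions cos (on [0,pi/k]), t^2, cosh. *)
Definition cat_comparison (kappa a b c s D : R) : Prop :=
  (0 < kappa -> let k := sqrt kappa in
     cos (k * b) * sin (k * (a - s)) + cos (k * c) * sin (k * s) <= cos (k * D) * sin (k * a)) /\
  (kappa = 0 ->
     D ^ 2 * a <= b ^ 2 * (a - s) + c ^ 2 * s - s * (a - s) * a) /\
  (kappa < 0 -> let k := sqrt (- kappa) in
     cosh (k * D) * sinh (k * a) <= cosh (k * b) * sinh (k * (a - s)) + cosh (k * c) * sinh (k * s)).

(* "x < varpi_kappa" where varpi_kappa = pi/sqrt kappa for kappa>0, +infinity else *)
Definition below_varpi (kappa x : R) : Prop :=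
  kappa <= 0 \/ x < PI / sqrt kappa.

Definition CAT (kappa : R) {X : Type} (d : X -> X -> R) : Prop :=
  (forall x y, below_varpi kappa (d x y) -> exists sigma, geodesic_between d sigma x y) /\
  (forall x y p sigma s,
      geodesic_between d sigma x y ->
      below_varpi kappa ((d x y + d p x + d p y) / 2) ->
      0 < d x y -> 0 <= s <= d x y ->
      cat_comparison kappa (d x y) (d p x) (d p y) s (d p (sigma s))).

Definition open_prod {X : Type} (d : X -> X -> R) (O : X -> R -> Prop) : Prop :=
  forall x t, O x t -> exists r, 0 < r /\
    forall y s, d x y < r -> Rabs (s - t) < r -> O y s.

Definition closed_prod {X : Type} (d : X -> X -> R) (K : X -> R -> Prop) : Prop :=
  forall x t, (forall r, 0 < r -> exists y s, K y s /\ d x y < r /\ Rabs (s - t) < r) ->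
    K x t.

(* f t is the function f_t; its domain is {x | Omega x t}. *)
Definition lipschitz_family {X : Type} (d : X -> X -> R) (Omega : X -> R -> Prop)
    (f : R -> X -> R) : Prop :=
  exists L, forall x t y s, Omega x t -> Omega y s ->
    Rabs (f t x - f s y) <= L * (d x y + Rabs (t - s)).

Definition concave_on (g : R -> R) (lo hi : R) : Prop :=
  forall u v th, lo <= u <= hi -> lo <= v <= hi -> 0 <= th <= 1 ->
    th * g u + (1 - th) * g v <= g (th * u + (1 - th) * v).

Definition lambda_concave_on {X : Type} (d : X -> X -> R) (g : X -> R) (D : X -> Prop)
    (lam : R) : Prop :=
  forall sigma lo hi, lo <= hi -> unit_geodesic_on d sigma lo hi ->
    (forall u, lo <= u <= hi -> D (sigma u)) ->
    concave_on (fun s => g (sigma s) - lam / 2 * s ^ 2) lo hi.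

Definition locally_semiconcave {X : Type} (d : X -> X -> R) (Omega : X -> R -> Prop)
    (f : R -> X -> R) : Prop :=
  forall p0 t0, Omega p0 t0 ->
    exists (O' : X -> R -> Prop) (r lam : R), 0 < r /\
      (forall y s, d p0 y < r -> Rabs (s - t0) < r -> O' y s) /\
      (forall y s, O' y s -> Omega y s) /\
      forall t, lambda_concave_on d (f t) (fun x => O' x t) lam.

(* D = d_q g(up_q^p): right derivative at 0 of g along the geodesic sigma from q *)
Definition right_deriv {X : Type} (g : X -> R) (q : X) (sigma : R -> X) (D : R) : Prop :=
  forall e, 0 < e -> exists delta, 0 < delta /\ forall eps, 0 < eps < delta ->
    Rabs ((g (sigma eps) - g q) / eps - D) < e.

(* ---------- extended reals for interval endpoints: None = +infinity ---------- *)
Definition in_Ico (a : R) (b : option R) (t : R) : Prop :=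
  a <= t /\ match b with Some b' => t < b' | None => True end.

Definition ER_lt (a : R) (b : option R) : Prop :=
  match b with Some b' => a < b' | None => True end.

Definition ER_le (c b : option R) : Prop :=
  match c, b with
  | _, None => True
  | None, Some _ => False
  | Some c', Some b' => c' <= b'
  end.

Definition gradient_curve {X : Type} (d : X -> X -> R) (Omega : X -> R -> Prop)
    (f : R -> X -> R) (alpha : R -> X) (a : R) (b : option R) : Prop :=
  (exists L, forall s t, in_Ico a b s -> in_Ico a b t ->
       d (alpha s) (alpha t) <= L * Rabs (s - t)) /\
  (forall t, in_Ico a b t -> Omega (alpha t) t) /\
  (forall t p sigma D, in_Ico a b t -> p <> alpha t ->
     geodesic_between d sigma (alpha t) p ->
     right_deriv (f t) (alpha t) sigma D ->
     forall e, 0 < e -> exists delta, 0 < delta /\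
       forall eps, 0 < eps < delta -> in_Ico a b (t + eps) ->
         d p (alpha (t + eps)) <= d p (alpha t) - eps * D + e * eps).

(* Main.v *)
Require Import Defs.
From Stdlib Require Import Reals Lra Lia Psatz ClassicalEpsilon.
From Coquelicot Require Import Coquelicot.
Open Scope R_scope.

(** The curve is built as a limit of implicit Euler chains.  One step of length [h] from
    [x] goes to a point [y] that almost maximises [f t y - d x y ^ 2 / (2 h)]; testing
    this against the point of a geodesic [y z] at distance [h ^ 2] from [y], the CAT(kappa)
    inequality and semiconcavity give the evolution variational inequality
<<
      d(y,z)^2 <= d(x,z)^2 + 2 h (f_t x - f_t z) + lam h d(x,z)^2 + C h^2
>>
    for all nearby [z].  On a small ball, curvature only enters the error [C h^2], because
    [d x y = O(h)].  Steps compose, with the same [C], into longer steps, and as the [f_t]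
    are Lipschitz two chains of mesh [delta] from the same point stay at squared distance
    [O(delta)]; hence chains converge, the limit satisfies the inequality between any two
    times, and letting [z] approach the curve along a geodesic turns it into the defining
    property of a gradient curve, with speed at most [2 L + 2].

    For two gradient curves, applying the definition with the midpoint of their positions
    and using semiconcavity bounds the upper derivative of the distance by [lam] times
    the distance, which gives uniqueness.  Uniqueness transfers the speed bound to every
    gradient curve, so a curve with a finite lifetime has an endpoint, from which it could
    be continued if that endpoint were in [Omega]. *)

(** * Comparison estimates in the model planes *)

(** The Taylor bounds on [cosh] and [sinh] below are obtained by integrating inequalities between
    derivatives in this form. *)
Lemma le_of_derive_le (f g f' g' : R -> R) (a b : R) :
  (forall x, is_derive f x (f' x)) -> (forall x, is_derive g x (g' x)) ->
  a <= b -> (forall x, a <= x <= b -> f' x <= g' x) ->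
  f b - f a <= g b - g a.
Proof.
intros Hf Hg [Hab | ->] Hle; [|lra].
destruct (MVT_cor2 (fun x => g x - f x) (fun x => g' x - f' x) a b Hab)
  as [c [Hc Hcab]].
- intros c _; apply is_derive_Reals.
  apply (is_derive_minus g f); [apply Hg | apply Hf].
- assert (f' c <= g' c) by (apply Hle; lra).
  nra.
Qed.

Lemma is_derive_cosh x : is_derive cosh x (sinh x).
Proof. apply is_derive_Reals, derivable_pt_lim_cosh. Qed.

Lemma is_derive_sinh x : is_derive sinh x (cosh x).
Proof. apply is_derive_Reals, derivable_pt_lim_sinh. Qed.

Lemma cosh_opp x : cosh (- x) = cosh x.
Proof. unfold cosh; rewrite Ropp_involutive; lra. Qed.

Lemma sinh_opp x : sinh (- x) = - sinh x.
Proof. unfold sinh; rewrite Ropp_involutive; lra. Qed.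

Lemma cosh_minus x y : cosh (x - y) = cosh x * cosh y - sinh x * sinh y.
Proof.
unfold cosh, sinh; replace (- (x - y)) with (- x + y) by ring.
unfold Rminus; rewrite !exp_plus; field.
Qed.

Lemma sinh_minus x y : sinh (x - y) = sinh x * cosh y - cosh x * sinh y.
Proof.
unfold cosh, sinh; replace (- (x - y)) with (- x + y) by ring.
unfold Rminus; rewrite !exp_plus; field.
Qed.

Lemma cosh_ge_1 x : 1 <= cosh x.
Proof.
unfold cosh; rewrite exp_Ropp.
assert (0 < exp x) by apply exp_pos.
replace ((exp x + / exp x) / 2) with (1 + (exp x - 1) ^ 2 / (2 * exp x)) by (field; lra).
assert (0 <= (exp x - 1) ^ 2 / (2 * exp x)); [|lra].
apply Rdiv_le_0_compat; [apply pow2_ge_0 | lra].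
Qed.

Lemma cosh_le_2 x : 0 <= x <= 1 -> cosh x <= 2.
Proof.
intros Hx; unfold cosh.
assert (exp x <= exp 1).
{ destruct (Req_dec x 1) as [->|]; [lra|left; apply exp_increasing; lra]. }
assert (exp (- x) <= 1).
{ rewrite <- exp_0; destruct (Req_dec x 0) as [->|]; [right; f_equal; lra|].
  left; apply exp_increasing; lra. }
assert (H3 := exp_le_3); lra.
Qed.

Lemma sinh_ge x : 0 <= x -> x <= sinh x.
Proof.
intros Hx.
assert (H := le_of_derive_le (fun x => x) sinh (fun _ => 1) cosh 0 x).
rewrite sinh_0 in H; cut (x - 0 <= sinh x - 0); [lra|apply H]; auto.
- intros y; auto_derive; auto.
- apply is_derive_sinh.
- intros; apply cosh_ge_1.
Qed.

Lemma cosh_diff_ge x y : 0 <= x <= y -> (y ^ 2 - x ^ 2) / 2 <= cosh y - cosh x.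
Proof.
intros Hx.
assert (H := le_of_derive_le (fun x => x ^ 2 / 2) cosh (fun x => x) sinh x y).
cut (y ^ 2 / 2 - x ^ 2 / 2 <= cosh y - cosh x); [lra|apply H]; try lra.
- intros z; auto_derive; auto; field.
- apply is_derive_cosh.
- intros z Hz; apply sinh_ge; lra.
Qed.

Lemma cosh_ge x : 1 + x ^ 2 / 2 <= cosh x.
Proof.
destruct (Rle_dec 0 x).
- assert (H := cosh_diff_ge 0 x); rewrite cosh_0 in H; lra.
- rewrite <- cosh_opp; assert (H := cosh_diff_ge 0 (- x)).
  rewrite cosh_0 in H; lra.
Qed.

(** Bootstrapped from [cosh <= 2]: integrating gives [sinh x <= 2 * x], then [cosh x <= 1 + x ^ 2],
    then [sinh x <= x + x ^ 3 / 3]. *)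
Lemma sinh_le x : 0 <= x <= 1 -> sinh x <= x + x ^ 3.
Proof.
assert (H2 : forall x, 0 <= x <= 1 -> sinh x <= 2 * x).
{ intros y Hy.
  assert (H := le_of_derive_le sinh (fun x => 2 * x) cosh (fun _ => 2) 0 y).
  rewrite sinh_0 in H; cut (sinh y - 0 <= 2 * y - 2 * 0); [lra|apply H]; try lra.
  - apply is_derive_sinh.
  - intros z; auto_derive; auto; ring.
  - intros z Hz; apply cosh_le_2; lra. }
assert (H3 : forall x, 0 <= x <= 1 -> cosh x <= 1 + x ^ 2).
{ intros y Hy.
  assert (H := le_of_derive_le cosh (fun x => x ^ 2) sinh (fun x => 2 * x) 0 y).
  rewrite cosh_0 in H; cut (cosh y - 1 <= y ^ 2 - 0 ^ 2); [lra|apply H]; try lra.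
  - apply is_derive_cosh.
  - intros z; auto_derive; auto; ring.
  - intros z Hz; apply H2; lra. }
intros Hx.
assert (H := le_of_derive_le sinh (fun x => x + x ^ 3 / 3) cosh (fun x => 1 + x ^ 2) 0 x).
rewrite sinh_0 in H.
cut (sinh x - 0 <= x + x ^ 3 / 3 - (0 + 0 ^ 3 / 3)).
{ assert (0 <= x ^ 3) by (apply pow_le; lra); lra. }
apply H; try lra.
- apply is_derive_sinh.
- intros z; auto_derive; auto; field.
- intros z Hz; apply H3; lra.
Qed.

Lemma cosh_le x : 0 <= x <= 1 -> cosh x <= 1 + x ^ 2 / 2 + x ^ 4.
Proof.
intros Hx.
assert (H := le_of_derive_le cosh (fun x => x ^ 2 / 2 + x ^ 4 / 4) sinh
  (fun x => x + x ^ 3) 0 x).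
rewrite cosh_0 in H.
cut (cosh x - 1 <= x ^ 2 / 2 + x ^ 4 / 4 - (0 ^ 2 / 2 + 0 ^ 4 / 4)).
{ assert (0 <= x ^ 4) by (apply pow_le; lra); lra. }
apply H; try lra.
- apply is_derive_cosh.
- intros z; auto_derive; auto; field.
- intros z Hz; apply sinh_le; lra.
Qed.

Lemma sinh_le_mul_cosh x : 0 <= x -> sinh x <= x * cosh x.
Proof.
intros Hx.
assert (H := le_of_derive_le sinh (fun x => x * cosh x) cosh
  (fun x => cosh x + x * sinh x) 0 x).
rewrite sinh_0 in H.
cut (sinh x - 0 <= x * cosh x - 0 * cosh 0); [lra|apply H]; try lra.
- apply is_derive_sinh.
- intros z.
  replace (cosh z + z * sinh z) with (plus (mult 1 (cosh z)) (mult z (sinh z)))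
    by (unfold plus, mult; simpl; ring).
  apply (is_derive_mult (fun z => z) cosh);
    [auto_derive; auto | apply is_derive_cosh | intros; apply Rmult_comm].
- intros z Hz; assert (z <= sinh z) by (apply sinh_ge; lra); nra.
Qed.

Lemma cos_bounds x : Rabs x <= 1 ->
  1 - x ^ 2 / 2 <= cos x <= 1 - x ^ 2 / 2 + x ^ 4 / 24.
Proof.
intros H; apply Rabs_le_between in H.
assert (Hc := pre_cos_bound x 0 ltac:(lra) ltac:(lra)).
unfold cos_approx, cos_term in Hc; simpl in Hc; lra.
Qed.

Lemma sin_bounds x : 0 <= x <= 1 -> x - x ^ 3 / 6 <= sin x <= x.
Proof.
intros H; split.
- assert (Hc := pre_sin_bound x 0 ltac:(lra) ltac:(lra)).
  unfold sin_approx, sin_term in Hc; simpl in Hc; lra.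
- destruct (Req_dec x 0) as [->|]; [rewrite sin_0; lra|].
  left; apply sin_lt_x; lra.
Qed.

(** The end of the argument common to both signs of curvature: [P] is [sin s] or [sinh s], and [E]
    is the error of replacing trigonometric terms by [b ^ 2 + l ^ 2 - c ^ 2]. Replacing [P] by [s]
    costs at most [4 * s ^ 3], and [P * E] is at most [6 * M ^ 5 * h ^ 4], whence
    [30 = 20 + 6 + 4]. *)
Lemma comparison_error_le (M l b c s D h P E : R) :
  1 <= M -> 0 < h <= 1 -> 0 < l <= 1 -> 0 <= b <= 1 -> Rabs (l - c) <= b ->
  0 <= c -> 0 <= s <= 1 -> s <= M * h ^ 2 ->
  0 <= P <= 2 * s -> Rabs (P - s) <= s ^ 3 ->
  0 <= E <= 3 * M ^ 4 * h ^ 2 ->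
  l * D ^ 2 <= l * b ^ 2 + 20 * M ^ 4 * h ^ 4 - P * (b ^ 2 + l ^ 2 - c ^ 2 - E) ->
  l * D ^ 2 <= l * b ^ 2 - s * (b ^ 2 + l ^ 2 - c ^ 2) + 30 * M ^ 5 * h ^ 4.
Proof.
intros HM Hh Hl Hb Hc Hc0 Hs HsM HP HPs HE H.
apply Rabs_le_between in Hc; apply Rabs_le_between in HPs.
set (W := b ^ 2 + l ^ 2 - c ^ 2) in *.
assert (HW : -4 <= W <= 4) by (unfold W; nra).
assert (H1 : s ^ 3 <= s ^ 2) by nra.
assert (H2 : s ^ 2 <= (M * h ^ 2) ^ 2) by (apply pow_incr; lra).
assert (H3 : (M * h ^ 2) ^ 2 = M ^ 2 * h ^ 4) by ring.
assert (Hh4 : 0 <= h ^ 4) by (apply pow_le; lra).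
assert (HM4 : 1 <= M ^ 4) by (apply pow_R1_Rle; lra).
assert (HM2 : M ^ 2 * h ^ 4 <= M ^ 5 * h ^ 4).
{ apply Rmult_le_compat_r; auto; apply Rle_pow; [lra|auto]. }
assert (HM5 : M ^ 4 * h ^ 4 <= M ^ 5 * h ^ 4).
{ apply Rmult_le_compat_r; auto; apply Rle_pow; [lra|auto]. }
assert (HPE : P * E <= 2 * (M * h ^ 2) * (3 * M ^ 4 * h ^ 2)).
{ apply Rmult_le_compat; lra. }
replace (2 * (M * h ^ 2) * (3 * M ^ 4 * h ^ 2)) with (6 * (M ^ 5 * h ^ 4)) in HPE by ring.
assert (HPW : P * W >= s * W - 4 * s ^ 3) by nra.
nra.
Qed.

(** A first-order expansion in [s] whose error is uniform as [l] tends to 0. With [c = l - u] and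
    [Rabs u <= b], dividing the hypothesis by [sin l] leaves [sin u] and [cos u - cos b] times the
    cotangent of [l]; only the cotangent is singular, and multiplying by [l] removes the
    singularity. *)
Lemma spherical_comparison_le (M l b c s D h : R) :
  1 <= M -> 0 < h <= 1 -> 0 < l <= 1 -> 0 <= b <= 1 -> Rabs (l - c) <= b ->
  0 <= c -> 0 <= s -> 0 <= D <= b + s -> b + s <= 1 ->
  b <= M * h -> s <= M * h ^ 2 ->
  cos b * sin (l - s) + cos c * sin s <= cos D * sin l ->
  l * D ^ 2 <= l * b ^ 2 - s * (b ^ 2 + l ^ 2 - c ^ 2) + 30 * M ^ 5 * h ^ 4.
Proof.
intros HM Hh Hl Hb Hc Hc0 Hs HD Hbs HbM HsM H.
assert (Hu := Hc); apply Rabs_le_between in Hc.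
set (u := l - c) in *.
assert (Hsl := sin_bounds l ltac:(lra)).
assert (Hss := sin_bounds s ltac:(lra)).
assert (Hs0 : 0 <= s ^ 3 <= s) by nra.
assert (Hl3 : l ^ 3 <= l) by nra.
assert (Hcl := cos_bounds l ltac:(apply Rabs_le; lra)).
assert (Hcb := cos_bounds b ltac:(apply Rabs_le; lra)).
assert (Hcs := cos_bounds s ltac:(apply Rabs_le; lra)).
assert (Hcu := cos_bounds u ltac:(lra)).
assert (HcD := cos_bounds D ltac:(apply Rabs_le; lra)).
assert (Hsu : u - b ^ 3 / 6 <= sin u).
{ destruct (Rle_dec 0 u) as [Hu0|Hu0].
  - assert (Hx := sin_bounds u ltac:(lra)).
    assert (u ^ 3 <= b ^ 3) by (apply pow_incr; lra); lra.
  - assert (Hx := sin_bounds (- u) ltac:(lra)); rewrite sin_neg in Hx.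
    assert (0 <= b ^ 3) by (apply pow_le; lra); lra. }
assert (Hq : 0 <= cos u - cos b).
{ assert (HPI := PI_4); assert (HPI2 := PI2_1).
  destruct (Rle_dec 0 u).
  - assert (cos b <= cos u) by (apply cos_decr_1; lra); lra.
  - rewrite <- (cos_neg u).
    assert (cos b <= cos (- u)) by (apply cos_decr_1; lra); lra. }
set (q := cos u - cos b) in *.
assert (Hcc : cos c = cos l * cos u + sin l * sin u).
{ replace c with (l - u) by (unfold u; ring); apply cos_minus. }
rewrite sin_minus, Hcc in H.
assert (H1 : cos b * cos s * sin l + sin s * (sin l * sin u + cos l * q) <= cos D * sin l).
{ unfold q; lra. }
(* [l * sin l * cot l >= (1 - l^2/2) * sin l] turns the cotangent into [1/l - l/2] *)
assert (H2 : sin l * (1 - l ^ 2 / 2) * q <= l * cos l * q).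
{ apply Rmult_le_compat_r; auto.
  apply Rle_trans with (l * (1 - l ^ 2 / 2)).
  - apply Rmult_le_compat_r; nra.
  - apply Rmult_le_compat_l; lra. }
assert (H3 : l * (cos b * cos s) + sin s * (l * sin u + (1 - l ^ 2 / 2) * q) <= l * cos D).
{ apply Rmult_le_reg_r with (sin l); [nra|].
  assert (0 <= sin s) by nra.
  assert (sin s * (sin l * (1 - l ^ 2 / 2) * q) <= sin s * (l * cos l * q)) by
    (apply Rmult_le_compat_l; auto).
  nra. }
assert (Hb2 : 0 <= b ^ 2) by nra.
assert (Hb3 : 0 <= b ^ 3) by (apply pow_le; lra).
assert (Hb4 : 0 <= b ^ 4) by (apply pow_le; lra).
(* Since [b ^ 2 + l ^ 2 - c ^ 2] is [b ^ 2 - u ^ 2 + 2 * l * u], the three terms bound the errors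
   made on [cos u - cos b], on the cotangent and on [sin u], in this order. *)
set (E := b ^ 4 / 12 + l ^ 2 * b ^ 2 / 2 + l * b ^ 3 / 3).
assert (HQ : (b ^ 2 + l ^ 2 - c ^ 2 - E) <= 2 * (l * sin u + (1 - l ^ 2 / 2) * q)).
{ replace c with (l - u) by (unfold u; ring).
  assert (l * (u - b ^ 3 / 6) <= l * sin u) by (apply Rmult_le_compat_l; lra).
  assert (q <= b ^ 2 / 2) by (unfold q; assert (Hx := COS_bound u); lra).
  assert (l ^ 2 / 2 * q <= l ^ 2 / 2 * (b ^ 2 / 2)) by (apply Rmult_le_compat_l; nra).
  assert ((b ^ 2 - u ^ 2) / 2 - b ^ 4 / 24 <= q) by (unfold q; lra).
  unfold E; nra. }
assert (Hh2 : h ^ 2 <= h) by nra.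
assert (HMh : 0 <= M * h) by nra.
assert (HsMh : s <= M * h) by nra.
apply (comparison_error_le M l b c s D h (sin s) E); auto; try lra.
- apply Rabs_le; lra.
- assert (Hb2' : b ^ 2 <= (M * h) ^ 2) by (apply pow_incr; lra).
  assert (Hl2 : 0 <= l ^ 2 <= 1) by nra.
  assert (Hlb2 : 0 <= l ^ 2 * b ^ 2 <= b ^ 2) by nra.
  assert (Hlb3 : 0 <= l * b ^ 3 <= b ^ 2) by nra.
  assert (Hb42 : b ^ 4 <= b ^ 2) by nra.
  assert (HM24 : M ^ 2 * h ^ 2 <= M ^ 4 * h ^ 2).
  { apply Rmult_le_compat_r; [nra|]; apply Rle_pow; [lra|auto]. }
  replace ((M * h) ^ 2) with (M ^ 2 * h ^ 2) in Hb2' by ring.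
  unfold E; lra.
- assert (HD4 : D ^ 4 <= (2 * (M * h)) ^ 4) by (apply pow_incr; lra).
  replace ((2 * (M * h)) ^ 4) with (16 * (M ^ 4 * h ^ 4)) in HD4 by ring.
  assert (Hs2 : s ^ 2 <= (M * h ^ 2) ^ 2) by (apply pow_incr; lra).
  replace ((M * h ^ 2) ^ 2) with (M ^ 2 * h ^ 4) in Hs2 by ring.
  assert (Hh4 : 0 <= h ^ 4) by (apply pow_le; lra).
  assert (HM24 : M ^ 2 * h ^ 4 <= M ^ 4 * h ^ 4).
  { apply Rmult_le_compat_r; auto; apply Rle_pow; [lra|auto]. }
  assert (Hbs2 : 2 - b ^ 2 - s ^ 2 <= 2 * (cos b * cos s)).
  { assert ((1 - b ^ 2 / 2) * (1 - s ^ 2 / 2) <= cos b * cos s).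
    { apply Rmult_le_compat; nra. }
    nra. }
  assert (HDD : l * D ^ 2 <= l * (2 - 2 * cos D + D ^ 4 / 12)) by
    (apply Rmult_le_compat_l; lra).
  assert (HPQ : sin s * (b ^ 2 + l ^ 2 - c ^ 2 - E) <=
    sin s * (2 * (l * sin u + (1 - l ^ 2 / 2) * q))) by
    (apply Rmult_le_compat_l; lra).
  assert (HL1 : l * (2 - b ^ 2 - s ^ 2) <= l * (2 * (cos b * cos s))) by
    (apply Rmult_le_compat_l; lra).
  assert (HL2 : l * (s ^ 2 + D ^ 4 / 12) <= 20 * (M ^ 4 * h ^ 4)) by nra.
  lra.
Qed.

(** The same substitution [c = l - u]. Here [sinh l <= l * cosh l] handles the cotangent without
    error, and [1 + D ^ 2 / 2 <= cosh D] bounds [D ^ 2] directly. *)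
Lemma hyperbolic_comparison_le (M l b c s D h : R) :
  1 <= M -> 0 < h <= 1 -> 0 < l <= 1 -> 0 <= b <= 1 -> Rabs (l - c) <= b ->
  0 <= c -> 0 <= s -> b + s <= 1 ->
  b <= M * h -> s <= M * h ^ 2 ->
  cosh D * sinh l <= cosh b * sinh (l - s) + cosh c * sinh s ->
  l * D ^ 2 <= l * b ^ 2 - s * (b ^ 2 + l ^ 2 - c ^ 2) + 30 * M ^ 5 * h ^ 4.
Proof.
intros HM Hh Hl Hb Hc Hc0 Hs Hbs HbM HsM H.
apply Rabs_le_between in Hc as Hc'.
set (u := l - c) in *.
assert (Hsl := sinh_ge l ltac:(lra)).
assert (Hss1 := sinh_ge s ltac:(lra)).
assert (Hss2 := sinh_le s ltac:(lra)).
assert (Hs0 : 0 <= s ^ 3 <= s) by nra.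
assert (Hcb := cosh_le b ltac:(lra)).
assert (Hcs := cosh_le s ltac:(lra)).
assert (HcD := cosh_ge D).
assert (Hb2 : 0 <= b ^ 2) by nra.
assert (Hb3 : 0 <= b ^ 3) by (apply pow_le; lra).
assert (Hb4 : 0 <= b ^ 4) by (apply pow_le; lra).
assert (Hsu : u - b ^ 3 <= sinh u).
{ destruct (Rle_dec 0 u).
  - assert (Hx := sinh_ge u ltac:(lra)); lra.
  - assert (Hx := sinh_le (- u) ltac:(lra)); rewrite sinh_opp in Hx.
    assert ((- u) ^ 3 <= b ^ 3) by (apply pow_incr; lra); lra. }
assert (Hq : (b ^ 2 - u ^ 2) / 2 <= cosh b - cosh u).
{ destruct (Rle_dec 0 u).
  - apply cosh_diff_ge; lra.
  - rewrite <- (cosh_opp u); replace (u ^ 2) with ((- u) ^ 2) by ring.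
    apply cosh_diff_ge; lra. }
set (q := cosh b - cosh u) in *.
assert (Hcc : cosh c = cosh l * cosh u - sinh l * sinh u).
{ replace c with (l - u) by (unfold u; ring); apply cosh_minus. }
rewrite sinh_minus, Hcc in H.
assert (H1 : cosh D * sinh l <= cosh b * cosh s * sinh l - sinh s * (sinh l * sinh u + cosh l * q)).
{ unfold q; lra. }
assert (Hq0 : 0 <= q) by nra.
assert (H2 : sinh l * q <= l * cosh l * q).
{ apply Rmult_le_compat_r; auto; apply sinh_le_mul_cosh; lra. }
assert (H3 : l * cosh D <= l * (cosh b * cosh s) - sinh s * (l * sinh u + q)).
{ apply Rmult_le_reg_r with (sinh l); [lra|].
  assert (sinh s * (sinh l * q) <= sinh s * (l * cosh l * q)) by
    (apply Rmult_le_compat_l; lra).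
  nra. }
set (E := 2 * (l * b ^ 3)).
assert (HQ : (b ^ 2 + l ^ 2 - c ^ 2 - E) <= 2 * (l * sinh u + q)).
{ replace c with (l - u) by (unfold u; ring).
  assert (l * (u - b ^ 3) <= l * sinh u) by (apply Rmult_le_compat_l; lra).
  unfold E; nra. }
assert (Hh2 : h ^ 2 <= h) by nra.
assert (HMh : 0 <= M * h) by nra.
assert (HsMh : s <= M * h) by nra.
assert (Hs3 : s ^ 3 <= s) by lra.
apply (comparison_error_le M l b c s D h (sinh s) E); auto; try lra.
- apply Rabs_le; lra.
- assert (Hb2' : b ^ 2 <= (M * h) ^ 2) by (apply pow_incr; lra).
  assert (Hlb3 : 0 <= l * b ^ 3 <= b ^ 2) by nra.
  assert (HM24 : M ^ 2 * h ^ 2 <= M ^ 4 * h ^ 2).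
  { apply Rmult_le_compat_r; [nra|]; apply Rle_pow; [lra|auto]. }
  replace ((M * h) ^ 2) with (M ^ 2 * h ^ 2) in Hb2' by ring.
  unfold E; lra.
- assert (Hb4' : b ^ 4 <= (M * h) ^ 4) by (apply pow_incr; lra).
  replace ((M * h) ^ 4) with (M ^ 4 * h ^ 4) in Hb4' by ring.
  assert (Hs2 : s ^ 2 <= (M * h ^ 2) ^ 2) by (apply pow_incr; lra).
  replace ((M * h ^ 2) ^ 2) with (M ^ 2 * h ^ 4) in Hs2 by ring.
  assert (Hh4 : 0 <= h ^ 4) by (apply pow_le; lra).
  assert (HM24 : M ^ 2 * h ^ 4 <= M ^ 4 * h ^ 4).
  { apply Rmult_le_compat_r; auto; apply Rle_pow; [lra|auto]. }
  assert (Hbs2 : 2 * (cosh b * cosh s) <= 2 + b ^ 2 + 2 * b ^ 4 + 10 * s ^ 2).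
  { assert (Hs21 : 0 <= s ^ 2 <= 1) by nra.
    assert (Hs42 : s ^ 4 <= s ^ 2) by nra.
    assert (Hb21 : b ^ 2 <= 1) by nra.
    assert (Hb41 : b ^ 4 <= 1) by nra.
    assert (cosh b * cosh s <= (1 + b ^ 2 / 2 + b ^ 4) * (1 + 3 / 2 * s ^ 2)).
    { apply Rmult_le_compat; try lra.
      - assert (Hx := cosh_ge_1 b); lra.
      - assert (Hx := cosh_ge_1 s); lra. }
    nra. }
  assert (HDD : l * D ^ 2 <= l * (2 * cosh D - 2)) by
    (apply Rmult_le_compat_l; lra).
  assert (HPQ : sinh s * (b ^ 2 + l ^ 2 - c ^ 2 - E) <=
    sinh s * (2 * (l * sinh u + q))) by
    (apply Rmult_le_compat_l; lra).
  assert (HL1 : l * (2 * (cosh b * cosh s)) <= l * (2 + b ^ 2 + 2 * b ^ 4 + 10 * s ^ 2)) by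
    (apply Rmult_le_compat_l; lra).
  assert (HL2 : l * (2 * b ^ 4 + 10 * s ^ 2) <= 20 * (M ^ 4 * h ^ 4)) by nra.
  lra.
Qed.

(* The parameter [h] is the time step: it will be used with [b = O(h)] and [s = h^2]. *)
Definition cat_estimate (kappa M r K : R) : Prop :=
  (forall x, x <= r -> below_varpi kappa x) /\
  forall l b c s D h, 0 < h <= 1 -> 0 < l <= r -> 0 <= b -> Rabs (l - c) <= b ->
    0 <= c -> 0 <= s -> 0 <= D <= b + s -> b + s <= r ->
    b <= M * h -> s <= M * h ^ 2 ->
    cat_comparison kappa l b c s D ->
    l * D ^ 2 <= l * b ^ 2 - s * (b ^ 2 + l ^ 2 - c ^ 2) + K * h ^ 4.

(** For [kappa = 0] Stewart's formula leaves the single error [l * s ^ 2]. Otherwise lengths are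
    multiplied by [k], the square root of the absolute value of [kappa], which reduces to curvature
    1 or -1 with [M] replaced by [(k + 1) * M], a constant that is at least 1 and dominates
    [k * M]. *)
Lemma cat_estimate_exists (kappa M : R) : 1 <= M ->
  exists r0 K, 0 < r0 /\ 0 <= K /\ forall r, r <= r0 -> cat_estimate kappa M r K.
Proof.
intros HM.
destruct (Req_dec kappa 0) as [->|Hk0].
{ exists 1, (M ^ 2); split; [lra|]; split; [nra|].
  intros r Hr; split; [intros; left; lra|].
  intros l b c s D h Hh Hl Hb Hc Hc0 Hs HD Hbs HbM HsM [_ [H _]].
  specialize (H eq_refl).
  assert (Hs2 : s ^ 2 <= (M * h ^ 2) ^ 2) by (apply pow_incr; lra).
  replace ((M * h ^ 2) ^ 2) with (M ^ 2 * h ^ 4) in Hs2 by ring.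
  assert (l * s ^ 2 <= s ^ 2) by nra.
  lra. }
set (k := sqrt (Rabs kappa)).
assert (Hk : 0 < k) by (apply sqrt_lt_R0, Rabs_pos_lt; auto).
(* With this radius rescaled lengths are below 1, which also puts lengths up to [r0] below
   [PI / k]. *)
set (r0 := / (k + 1)).
assert (Hr0 : 0 < r0) by (apply Rinv_0_lt_compat; lra).
assert (Hkr : k * r0 < 1).
{ apply Rmult_lt_reg_r with (k + 1); [lra|]; unfold r0.
  rewrite Rmult_assoc, Rinv_l; lra. }
(* The estimate is cubic in the lengths while [h] is not rescaled, hence the division by [k ^ 3]. *)
exists r0, (30 * ((k + 1) * M) ^ 5 / k ^ 3).
assert (Hk3 : 0 < k ^ 3) by (apply pow_lt; auto).
assert (HM' : 1 <= (k + 1) * M) by nra.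
assert (HM5 : 0 <= ((k + 1) * M) ^ 5) by (apply pow_le; lra).
split; [auto|]; split; [apply Rdiv_le_0_compat; lra|].
intros r Hr; split.
{ intros x Hx.
  destruct (Rle_dec kappa 0) as [Hle|Hgt]; [left; auto|right].
  assert (Hkk : sqrt kappa = k) by (unfold k; rewrite Rabs_pos_eq; lra).
  rewrite Hkk; apply Rmult_lt_reg_r with k; auto.
  assert (HPI := PI2_3_2).
  unfold Rdiv; rewrite Rmult_assoc, Rinv_l; nra. }
intros l b c s D h Hh Hl Hb Hc Hc0 Hs HD Hbs HbM HsM Hcat.
assert (H : k * l * (k * D) ^ 2 <= k * l * (k * b) ^ 2
  - k * s * ((k * b) ^ 2 + (k * l) ^ 2 - (k * c) ^ 2)
  + 30 * ((k + 1) * M) ^ 5 * h ^ 4).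
{ assert (Hkl : 0 < k * l <= 1) by nra.
  assert (Hkb : 0 <= k * b <= 1) by nra.
  assert (Hkc : Rabs (k * l - k * c) <= k * b).
  { rewrite <- Rmult_minus_distr_l, Rabs_mult, (Rabs_pos_eq k) by lra.
    apply Rmult_le_compat_l; lra. }
  assert (Hkbs : k * b + k * s <= 1) by nra.
  assert (HkbM : k * b <= (k + 1) * M * h) by nra.
  assert (HksM : k * s <= (k + 1) * M * h ^ 2) by nra.
  destruct Hcat as [Hpos [_ Hneg]].
  destruct (Rle_dec kappa 0) as [Hle|Hgt].
  - assert (Hkk : sqrt (- kappa) = k) by (unfold k; rewrite Rabs_left1; lra).
    apply hyperbolic_comparison_le; auto; try nra.
    replace (k * l - k * s) with (k * (l - s)) by ring.
    rewrite <- Hkk; apply Hneg; lra.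
  - assert (Hkk : sqrt kappa = k) by (unfold k; rewrite Rabs_pos_eq; lra).
    apply spherical_comparison_le; auto; try nra.
    replace (k * l - k * s) with (k * (l - s)) by ring.
    rewrite <- Hkk; apply Hpos; lra. }
apply Rmult_le_reg_l with (k ^ 3); auto.
replace (k ^ 3 * (l * b ^ 2 - s * (b ^ 2 + l ^ 2 - c ^ 2) + 30 * ((k + 1) * M) ^ 5 / k ^ 3 * h ^ 4))
 with (k * l * (k * b) ^ 2 - k * s * ((k * b) ^ 2 + (k * l) ^ 2 - (k * c) ^ 2)
  + 30 * ((k + 1) * M) ^ 5 * h ^ 4) by (field; lra).
lra.
Qed.

(** * Semiconcavity along geodesics *)

Lemma lambda_concave_on_geodesic {X : Type} (d : X -> X -> R) (g : X -> R)
    (D : X -> Prop) (lam : R) sigma l s :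
  lambda_concave_on d g D lam -> 0 < l -> 0 <= s <= l ->
  unit_geodesic_on d sigma 0 l -> (forall u, 0 <= u <= l -> D (sigma u)) ->
  l * g (sigma 0) + s * (g (sigma l) - g (sigma 0)) - lam / 2 * l * (s * (l - s))
    <= l * g (sigma s).
Proof.
intros Hg Hl Hs Hsig HD.
assert (H := Hg sigma 0 l ltac:(lra) Hsig HD 0 l (1 - s / l)).
assert (Hth : 0 <= s / l <= 1).
{ split; [apply Rdiv_le_0_compat; lra|].
  apply Rmult_le_reg_r with l; auto; unfold Rdiv.
  rewrite Rmult_assoc, Rinv_l; lra. }
specialize (H ltac:(lra) ltac:(lra) ltac:(lra)); cbv beta in H.
replace ((1 - s / l) * 0 + (1 - (1 - s / l)) * l) with s in H by (field; lra).
apply (Rmult_le_compat_l l) in H; [|lra].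
replace (l * ((1 - s / l) * (g (sigma 0) - lam / 2 * 0 ^ 2)
  + (1 - (1 - s / l)) * (g (sigma l) - lam / 2 * l ^ 2)))
  with (l * g (sigma 0) + s * (g (sigma l) - g (sigma 0)) - lam / 2 * l * (s * l)) in H
  by (field; lra).
lra.
Qed.

Lemma lambda_concave_on_le {X : Type} (d : X -> X -> R) (g : X -> R)
    (D D' : X -> Prop) (lam lam' : R) :
  lam <= lam' -> (forall x, D' x -> D x) ->
  lambda_concave_on d g D lam -> lambda_concave_on d g D' lam'.
Proof.
intros Hlam HD Hg sigma lo hi Hlh Hsig HDs u v th Hu Hv Hth.
assert (H := Hg sigma lo hi Hlh Hsig (fun w Hw => HD _ (HDs w Hw)) u v th Hu Hv Hth).
cbv beta in *.
assert (0 <= (lam' - lam) / 2 * (th * (1 - th) * (u - v) ^ 2)).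
{ apply Rmult_le_pos; [lra|]; apply Rmult_le_pos; [nra|apply pow2_ge_0]. }
nra.
Qed.

(** * Euler chains and their limit *)

Section LocalFlow.

Context {X : Type} (d : X -> X -> R) (f : R -> X -> R).
Context (p0 : X) (t0 r L lam : R).
Hypothesis Hm : is_metric d.
Hypothesis Hr : 0 < r <= 1.
Hypothesis HL : 0 <= L.
Hypothesis Hlam : 1 <= lam.
Hypothesis Hlip : forall x t y s,
  d p0 x < r -> Rabs (t - t0) < r -> d p0 y < r -> Rabs (s - t0) < r ->
  Rabs (f t x - f s y) <= L * (d x y + Rabs (t - s)).

Let dnn := d_nonneg d Hm.
Let dsym := d_sym d Hm.
Let dtri := d_tri d Hm.

Lemma d_self x : d x x = 0.
Proof. now apply (d_eq0 d Hm). Qed.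

(* The speed bound [2 L + 2] does not depend on the neighbourhood, unlike [lam] and [C]. *)
Definition evi_step (C : R) (x : X) (t : R) (y : X) (h : R) : Prop :=
  d x y <= (2 * L + 2) * h /\
  forall z, d p0 z <= r / 8 ->
    d y z ^ 2 <= d x z ^ 2 + 2 * h * (f t x - f t z) + lam * h * d x z ^ 2 + C * h ^ 2.

Lemma f_diff_le x t y s b e :
  d p0 x < r -> Rabs (t - t0) < r -> d p0 y < r -> Rabs (s - t0) < r ->
  d x y <= b -> Rabs (t - s) <= e -> f t x - f s y <= L * (b + e).
Proof.
intros Hx Ht Hy Hs Hb He.
assert (H := Hlip x t y s Hx Ht Hy Hs); apply Rabs_le_between in H.
assert (L * (d x y + Rabs (t - s)) <= L * (b + e)) by (apply Rmult_le_compat_l; lra).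
lra.
Qed.

(** Without local compactness the supremum need not be attained. The defect [h ^ 3] becomes
    [2 * h ^ 4] after multiplication by [2 * h], the order of the error in the comparison
    estimate. *)
Lemma near_maximizer x t h :
  d p0 x <= r / 8 -> Rabs (t - t0) < r -> 0 < h ->
  exists y, d x y <= r / 4 /\
    forall w, d x w <= r / 4 ->
      f t w - d x w ^ 2 / (2 * h) <= f t y - d x y ^ 2 / (2 * h) + h ^ 3.
Proof.
intros Hx Ht Hh.
set (E := fun v => exists y, d x y <= r / 4 /\ v = f t y - d x y ^ 2 / (2 * h)).
destruct (completeness E) as [m [Hub Hlub]].
- exists (f t x + L * (r / 4 + 0)); intros v [y [Hy ->]].
  assert (Hpy := dtri p0 x y).
  assert (f t y - f t x <= L * (r / 4 + 0)).
  { apply f_diff_le; auto; try lra; [now rewrite dsym|].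
    rewrite Rminus_diag, Rabs_R0; lra. }
  assert (0 <= d x y ^ 2 / (2 * h)).
  { apply Rdiv_le_0_compat; [apply pow2_ge_0|lra]. }
  lra.
- exists (f t x - d x x ^ 2 / (2 * h)), x; split; auto; rewrite d_self; lra.
- assert (Hh3 : 0 < h ^ 3) by (apply pow_lt; auto).
  apply NNPP; intros Hno.
  assert (m <= m - h ^ 3); [|lra].
  apply Hlub; intros v [y [Hy ->]].
  apply Rnot_lt_le; intros Hlt; apply Hno; exists y; split; auto.
  intros w Hw.
  assert (f t w - d x w ^ 2 / (2 * h) <= m) by (apply Hub; exists w; auto).
  lra.
Qed.

(** The inequality is the first-order condition satisfied by a near maximiser [y], tested at one
    nearby point of the geodesic from [y] to [z]. *)
Lemma evi_step_exists (kappa : R) : CAT kappa d ->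
  (forall t, Rabs (t - t0) < r ->
     lambda_concave_on d (f t) (fun x => d p0 x < r) lam) ->
  (exists K, 0 <= K /\ cat_estimate kappa (2 * L + 2) r K) ->
  exists C0 h0, 0 < h0 /\ forall C x t h, C0 <= C -> d p0 x <= r / 8 ->
    Rabs (t - t0) < r -> 0 < h <= h0 -> exists y, evi_step C x t y h.
Proof.
intros [Hgeo Hcat] Hconc [K [HK [Hvarpi Hcomp]]].
set (C1 := 2 * L + 2) in *.
assert (HC1 : 2 <= C1) by (unfold C1; lra).
(* The first two summands serve the case [d y z <= h], the bracket serves the other case. *)
set (C0 := 1 + 2 * L * (C1 + 1) + (K + 2 + 2 * L * C1 + 3 * lam * C1)).
set (h0 := r / 8 / C1).
assert (Hh0C : C1 * h0 = r / 8) by (unfold h0; field; lra).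
assert (Hh0 : 0 < h0) by nra.
exists C0, h0; split; auto.
intros C x t h HC Hx Ht Hh.
assert (HC1h : C1 * h <= r / 8) by nra.
assert (Hh1 : h <= 1 / 16) by nra.
destruct (near_maximizer x t h Hx Ht ltac:(lra)) as [y [Hxy Hmax]].
set (b := d x y) in *.
assert (Hb0 : 0 <= b) by apply dnn.
assert (Hpy : d p0 y <= 3 * r / 8) by (assert (H := dtri p0 x y); unfold b in *; lra).
assert (Htt : Rabs (t - t) <= 0) by (rewrite Rminus_diag, Rabs_R0; lra).
assert (Hfyx : f t y - f t x <= L * b).
{ replace (L * b) with (L * (b + 0)) by ring.
  apply f_diff_le; auto; try lra; rewrite dsym; unfold b; lra. }
assert (Hmul : forall A B e, A - B ^ 2 / (2 * h) <= e -> 2 * h * A - B ^ 2 <= 2 * h * e).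
{ intros A B e HA; apply (Rmult_le_compat_l (2 * h)) in HA; [|lra].
  replace (2 * h * (A - B ^ 2 / (2 * h))) with (2 * h * A - B ^ 2) in HA by (field; lra).
  lra. }
assert (Hmax' : forall w, d x w <= r / 4 ->
  2 * h * f t w - d x w ^ 2 <= 2 * h * f t y - b ^ 2 + 2 * h ^ 4).
{ intros w Hw; assert (H := Hmul _ _ _ (Hmax w Hw)).
  replace (2 * h * (f t y - b ^ 2 / (2 * h) + h ^ 3)) with
    (2 * h * f t y - b ^ 2 + 2 * h ^ 4) in H by (field; lra).
  exact H. }
(* Near-maximality is tested against [x] itself; the summand 2 in [C1] absorbs the defect. *)
assert (Hb : b <= C1 * h).
{ assert (H := Hmax' x); rewrite d_self in H; specialize (H ltac:(lra)).
  assert (Hh4 : h ^ 4 <= h ^ 2).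
  { assert (Hh2 : 0 <= h ^ 2 <= 1) by (split; nra).
    replace (h ^ 4) with (h ^ 2 * h ^ 2) by ring; nra. }
  apply Rnot_lt_le; intros Hlt.
  assert (Hhf : 2 * h * (f t y - f t x) <= 2 * h * (L * b)) by (apply Rmult_le_compat_l; lra).
  assert (Hb2 : b ^ 2 <= 2 * h * (L * b) + 2 * h ^ 2) by lra.
  assert (HCb : C1 * h * b <= b * b) by (apply Rmult_le_compat_r; lra).
  assert (Hhb : 2 * h * h < b * h) by (apply Rmult_lt_compat_r; [lra|nra]).
  assert (0 <= h ^ 2) by apply pow2_ge_0.
  unfold C1 in HCb; lra. }
exists y; split; [exact Hb|].
intros z Hz; fold b.
set (l := d y z); set (c := d x z).
assert (Hl0 : 0 <= l) by apply dnn.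
assert (Hc0 : 0 <= c) by apply dnn.
assert (Hc : c <= r / 4).
{ assert (H := dtri x p0 z); rewrite (dsym x p0) in H; unfold c; lra. }
assert (Hlb : l <= c + b).
{ assert (H := dtri y x z); rewrite (dsym y x) in H; unfold l, c, b; lra. }
assert (Hcb : c <= b + l) by apply dtri.
assert (Hh2 : 0 < h ^ 2) by nra.
assert (HCC : C0 * h ^ 2 <= C * h ^ 2) by (apply Rmult_le_compat_r; lra).
assert (Hlc : 0 <= lam * h * c ^ 2) by (apply Rmult_le_pos; nra).
(* If [l <= h], the left-hand side is at most [h ^ 2] and Lipschitz bounds suffice. Otherwise the
   point at distance [h ^ 2] from [y] lies on the geodesic. *)
destruct (Rle_lt_dec l h) as [Hlh|Hlh].
- assert (Hf : f t z - f t x <= L * (c + 0)).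
  { apply f_diff_le; auto; try lra; rewrite dsym; unfold c; lra. }
  assert (HLc : L * c <= L * ((C1 + 1) * h)) by (apply Rmult_le_compat_l; nra).
  assert (Hl2 : l ^ 2 <= h ^ 2) by (apply pow_incr; lra).
  assert (H2 : 2 * h * (f t z - f t x) <= 2 * h * (L * ((C1 + 1) * h))).
  { apply Rmult_le_compat_l; lra. }
  assert (Hrest : 0 <= (K + 2 + 2 * L * C1 + 3 * lam * C1) * h ^ 2).
  { apply Rmult_le_pos; [|lra]; assert (0 <= L * C1) by nra;
    assert (0 <= lam * C1) by nra; lra. }
  assert (0 <= c ^ 2) by apply pow2_ge_0.
  unfold C0 in HCC; lra.
- assert (Hl : l <= 3 * r / 8) by lra.
  destruct (Hgeo y z) as [sigma [Hsig [Hs0 Hsl]]].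
  { apply Hvarpi; fold l; lra. }
  fold l in Hsig, Hsl.
  assert (Hball : forall u, 0 <= u <= l -> d p0 (sigma u) < r).
  { intros u Hu; assert (H := dtri p0 y (sigma u)).
    assert (Hyu : d y (sigma u) = Rabs (0 - u)).
    { rewrite <- Hs0 at 1; apply Hsig; lra. }
    rewrite Rabs_left1 in Hyu; lra. }
  (* All errors below are of order [h ^ 4] and will be divided by [s]; the choice [s = h ^ 2] leaves
     an error of order [h ^ 2], while terms quadratic in [s] are again of order [h ^ 4]. *)
  set (s := h ^ 2); fold s in Hh2, HCC.
  assert (Hsh : s <= h) by (unfold s; nra).
  set (D := d x (sigma s)).
  assert (Hys : d y (sigma s) = s).
  { rewrite <- Hs0 at 1; rewrite Hsig by lra; rewrite Rabs_left1; lra. }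
  assert (HDle : D <= b + s).
  { assert (H := dtri x y (sigma s)); unfold D, b; lra. }
  assert (HD0 : 0 <= D) by apply dnn.
  assert (Hbs : b + s <= r / 4).
  { assert (h <= C1 * h) by nra; lra. }
  assert (HlD : l * D ^ 2 <= l * b ^ 2 - s * (b ^ 2 + l ^ 2 - c ^ 2) + K * h ^ 4).
  { apply Hcomp; try lra.
    - apply Rabs_le; lra.
    - unfold s; nra.
    - apply Hcat; fold l; try lra.
      + repeat split; auto.
      + apply Hvarpi; fold b c; lra. }
  assert (Hw := Hmax' (sigma s)); fold D in Hw; specialize (Hw ltac:(lra)).
  assert (Hcv := lambda_concave_on_geodesic d (f t) _ lam sigma l s (Hconc t Ht)
    ltac:(lra) ltac:(lra) Hsig Hball).
  rewrite Hs0, Hsl in Hcv.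
  apply (Rmult_le_compat_l l) in Hw; [|lra].
  apply (Rmult_le_compat_l (2 * h)) in Hcv; [|lra].
  assert (Hk4 : h ^ 4 = s * s) by (unfold s; ring).
  rewrite Hk4 in *.
  (* Near-maximality, comparison and concavity are added, and a common factor [s] is cancelled. *)
  assert (Hdiv : l ^ 2 <= c ^ 2 - b ^ 2 + 2 * h * (f t y - f t z)
    + lam * h * l * (l - s) + (K + 2 * l) * s).
  { apply Rmult_le_reg_l with s; auto; nra. }
  assert (Hl2 : l ^ 2 <= c ^ 2 + 3 * (C1 * h)).
  { assert (l ^ 2 <= (c + b) ^ 2) by (apply pow_incr; lra).
    assert (2 * c * b <= b) by nra.
    assert (b ^ 2 <= b) by nra.
    nra. }
  assert (Hll : lam * h * l * (l - s) <= lam * h * (c ^ 2 + 3 * (C1 * h))).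
  { assert (0 <= lam * h) by nra.
    assert (l * (l - s) <= c ^ 2 + 3 * (C1 * h)) by nra.
    replace (lam * h * l * (l - s)) with (lam * h * (l * (l - s))) by ring.
    apply Rmult_le_compat_l; lra. }
  assert (Hfy : 2 * h * (f t y - f t x) <= 2 * h * (L * (C1 * h))).
  { apply Rmult_le_compat_l; [lra|].
    assert (L * b <= L * (C1 * h)) by (apply Rmult_le_compat_l; lra); lra. }
  assert (Hkl : (K + 2 * l) * s <= (K + 2) * s) by (apply Rmult_le_compat_r; lra).
  assert (0 <= L * (C1 + 1) * s) by (apply Rmult_le_pos; nra).
  assert (0 <= b ^ 2) by nra.
  unfold C0 in HCC; unfold s in *; lra.
Qed.

Lemma sq_dist_le x y z b : d x z <= 1 / 4 -> d x y <= 1 / 4 -> d x y <= b ->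
  d y z ^ 2 <= d x z ^ 2 + b.
Proof.
intros Hxz Hxy Hb.
assert (H1 := dtri y x z); rewrite (dsym y x) in H1.
assert (H2 := dnn y z); assert (H3 := dnn x z); assert (H4 := dnn x y).
assert (d y z ^ 2 <= (d x y + d x z) ^ 2) by (apply pow_incr; lra).
nra.
Qed.

(** The constant survives because [C * (h + k) ^ 2] exceeds [C * h ^ 2 + C * k ^ 2] by
    [2 * C * h * k]. This cross term pays for replacing [f (t + h) y] by [f t x] and [d y z] by
    [d x z] in the second inequality. *)
Lemma evi_step_trans C x t y h w k :
  L * (2 * L + 4) + lam * (2 * L + 2) <= C -> 0 <= h -> 0 <= k ->
  d p0 x <= r / 8 -> d p0 y <= r / 8 ->
  Rabs (t - t0) < r -> Rabs (t + h - t0) < r ->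
  evi_step C x t y h -> evi_step C y (t + h) w k -> evi_step C x t w (h + k).
Proof.
intros HC Hh Hk Hx Hy Ht Hth [Hxy H1] [Hyw H2]; split.
{ assert (H := dtri x y w); lra. }
intros z Hz; specialize (H1 z Hz); specialize (H2 z Hz).
assert (Hc : d x z <= 1 / 4).
{ assert (H := dtri x p0 z); rewrite (dsym x p0) in H; lra. }
assert (Hb : d x y <= 1 / 4).
{ assert (H := dtri x p0 y); rewrite (dsym x p0) in H; lra. }
assert (Hyz := sq_dist_le x y z _ Hc Hb Hxy).
assert (Habs : Rabs (t + h - t) <= h) by (apply Rabs_le; lra).
assert (Hf1 : f (t + h) y - f t x <= L * ((2 * L + 2) * h + h)).
{ apply f_diff_le; auto; try lra; rewrite dsym; lra. }
assert (Hf2 : f t z - f (t + h) z <= L * (0 + h)).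
{ apply f_diff_le; auto; try lra; [rewrite d_self; lra|].
  rewrite Rabs_minus_sym; auto. }
assert (Hf : 2 * k * (f (t + h) y - f (t + h) z) <=
   2 * k * (f t x - f t z + L * (2 * L + 4) * h)).
{ apply Rmult_le_compat_l; lra. }
assert (Hl : lam * k * d y z ^ 2 <= lam * k * (d x z ^ 2 + (2 * L + 2) * h)).
{ apply Rmult_le_compat_l; nra. }
assert (HCC : 2 * (h * k) * (L * (2 * L + 4) + lam * (2 * L + 2)) <= 2 * (h * k) * C).
{ apply Rmult_le_compat_l; nra. }
assert (0 <= lam * (2 * L + 2) * (h * k)).
{ apply Rmult_le_pos; nra. }
lra.
Qed.

(** * Chains of steps of bounded length *)

Context (C h0 T : R).
Hypothesis HC : L * (2 * L + 4) + lam * (2 * L + 2) <= C.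
Hypothesis Hh0 : 0 < h0.
Hypothesis HT : 0 < T.
Hypothesis HTr : (2 * L + 2) * T <= r / 8.
Hypothesis Hstep : forall x t h, d p0 x <= r / 8 -> Rabs (t - t0) < r ->
  0 < h <= h0 -> exists y, evi_step C x t y h.

(** Steps may differ in length, so that chains can be concatenated. They are appended at the end,
    which is where the comparison of two chains removes them. *)
Inductive chain (delta : R) : nat -> X -> R -> X -> R -> Prop :=
| chain_nil x s : chain delta 0 x s x s
| chain_snoc n x s y t w h : chain delta n x s y t -> 0 < h <= delta ->
    evi_step C y t w h -> chain delta (S n) x s w (t + h).

Lemma chain_time delta n x s y t : chain delta n x s y t -> s <= t.
Proof. induction 1; lra. Qed.

Lemma chain_mono delta delta' n x s y t :
  delta <= delta' -> chain delta n x s y t -> chain delta' n x s y t.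
Proof.
intros Hd; induction 1; [constructor|]; econstructor; eauto; lra.
Qed.

Lemma chain_app delta n m x s y t w u :
  chain delta n x s y t -> chain delta m y t w u -> chain delta (n + m) x s w u.
Proof.
intros H1 H2; induction H2.
- now rewrite Nat.add_0_r.
- rewrite Nat.add_succ_r; econstructor; eauto.
Qed.

Lemma chain_dist delta n x s y t :
  chain delta n x s y t -> d x y <= (2 * L + 2) * (t - s).
Proof.
induction 1 as [x s|n x s y t w h H IH Hh [Hyw _]]; [rewrite d_self; lra|].
assert (Htr := dtri x y w); lra.
Qed.

Lemma time_in_range t : t0 <= t <= t0 + T -> Rabs (t - t0) < r.
Proof. intros Ht; rewrite Rabs_pos_eq; nra. Qed.

Lemma chain_ball delta n x s y t : chain delta n x s y t ->
  d p0 x + (2 * L + 2) * (t - s) <= r / 8 -> d p0 y <= r / 8.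
Proof.
intros H Hx; apply chain_dist in H; assert (Htr := dtri p0 x y); lra.
Qed.

(** As composition preserves [C], the number of steps does not enter; the empty chain is a step of
    length 0. *)
Lemma chain_evi delta n x s y t : chain delta n x s y t ->
  d p0 x + (2 * L + 2) * (t - s) <= r / 8 -> t0 <= s -> t <= t0 + T ->
  evi_step C x s y (t - s).
Proof.
induction 1 as [x s|n x s y t w h H IH Hh Hyw]; intros Hx Hs Ht.
- split; [rewrite d_self; lra|intros z _; lra].
- assert (Hst := chain_time _ _ _ _ _ _ H).
  assert (Hx' : d p0 x + (2 * L + 2) * (t - s) <= r / 8) by nra.
  replace (t + h - s) with ((t - s) + h) by ring.
  apply evi_step_trans with y; auto; try lra.
  + assert (0 <= (2 * L + 2) * (t - s)) by nra; lra.
  + eapply chain_ball; eauto.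
  + apply time_in_range; lra.
  + apply time_in_range; lra.
  + apply IH; auto; lra.
  + replace (s + (t - s)) with t by ring; auto.
Qed.

Lemma chain_exists delta n h x s : 0 < h <= delta -> h <= h0 ->
  d p0 x + (2 * L + 2) * (INR n * h) <= r / 8 -> t0 <= s -> s + INR n * h <= t0 + T ->
  exists y, chain delta n x s y (s + INR n * h).
Proof.
intros Hh Hhh; induction n as [|n IH]; intros Hx Hs Ht.
- exists x; simpl INR; replace (s + 0 * h) with s by ring; constructor.
- rewrite S_INR in *.
  assert (Hn := pos_INR n).
  destruct IH as [y Hy]; auto; try nra.
  destruct (Hstep y (s + INR n * h) h) as [w Hw].
  + eapply chain_ball; eauto; nra.
  + apply time_in_range; nra.
  + lra.
  + exists w; replace (s + (INR n + 1) * h) with (s + INR n * h + h) by ring.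
    econstructor; eauto; lra.
Qed.

Lemma chain_reach delta x s t : 0 < delta ->
  d p0 x + (2 * L + 2) * (t - s) <= r / 8 -> t0 <= s -> s <= t -> t <= t0 + T ->
  exists n y, chain delta n x s y t.
Proof.
intros Hd Hx Hs Hst Ht.
destruct Hst as [Hst| ->]; [|exists 0%nat, x; constructor].
set (e := Rmin delta h0).
assert (He : 0 < e) by (apply Rmin_pos; auto).
destruct (INR_unbounded ((t - s) / e)) as [n Hn].
assert (Hts : 0 < (t - s) / e) by (apply Rdiv_lt_0_compat; lra).
set (h := (t - s) / INR n).
assert (Hnh : INR n * h = t - s) by (unfold h; field; lra).
assert (Hh : 0 < h) by (apply Rdiv_lt_0_compat; lra).
assert (Hhe : h <= e).
{ assert (e * ((t - s) / e) = t - s) by (field; lra).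
  apply Rmult_le_reg_l with (INR n); [lra|]; nra. }
assert (He1 := Rmin_l delta h0); assert (He2 := Rmin_r delta h0); fold e in He1, He2.
destruct (chain_exists delta n h x s) as [y Hy]; try lra; rewrite ?Hnh in *; try lra.
exists n, y; replace t with (s + (t - s)) by ring; auto.
Qed.

(** Per unit of [h * delta], the summands are the error of the step, the Lipschitz variation of [f]
    along the step and in time, and the cost of replacing [d x y ^ 2] by the corrected squared
    distance. *)
Let K := C + 2 * L * (2 * L + 4) + 4 * lam * L.

(* [2 (s - tau) (f tau y - f s x)] compensates for the two chains not being
   synchronised: the first-order terms of a step of either chain cancel exactly. *)
Let G x s y tau := d x y ^ 2 + 2 * (s - tau) * (f tau y - f s x).

(** The variational inequality is used with [z = y]. Adding [K * delta] makes the quantity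
    nonnegative, so that [1 + lam * h] may be replaced by an exponential, and makes the recursion
    homogeneous: as [1 <= lam], the error [K * delta * h] is covered by the growth of the added
    term. *)
Lemma chain_compare_step delta x s x' h y tau : 0 < delta <= 1 -> 0 < h <= delta ->
  Rabs (s - tau) <= delta -> Rabs (s + h - tau) <= delta ->
  d p0 x <= r / 8 -> d p0 x' <= r / 8 -> d p0 y <= r / 8 ->
  t0 <= s -> s + h <= t0 + T -> t0 <= tau <= t0 + T ->
  evi_step C x s x' h ->
  G x' (s + h) y tau + K * delta <= exp (lam * h) * (G x s y tau + K * delta).
Proof.
intros Hd Hh Hst Hst' Hx Hx' Hy Hs Hsh Htau [Hxx' He].
specialize (He y Hy).
assert (Hrs : Rabs (s - t0) < r) by (apply time_in_range; lra).
assert (Hrsh : Rabs (s + h - t0) < r) by (apply time_in_range; lra).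
assert (Hrt : Rabs (tau - t0) < r) by (apply time_in_range; lra).
assert (HsL := Rabs_pos (s - tau)).
assert (Hc : d x y <= 1 / 4).
{ assert (H := dtri x p0 y); rewrite (dsym x p0) in H; lra. }
assert (Hf1 : f tau y - f s y <= L * (0 + delta)).
{ apply f_diff_le; auto; try lra; [rewrite d_self; lra|].
  rewrite Rabs_minus_sym; auto. }
assert (Hf2 : Rabs (f s x - f (s + h) x') <= L * (2 * L + 3) * h).
{ assert (H := Hlip x s x' (s + h) ltac:(lra) Hrs ltac:(lra) Hrsh).
  replace (s - (s + h)) with (- h) in H by ring; rewrite Rabs_Ropp, (Rabs_pos_eq h) in H by lra.
  assert (L * (d x x' + h) <= L * ((2 * L + 2) * h + h)) by (apply Rmult_le_compat_l; lra).
  lra. }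
assert (Hf3 : Rabs (f tau y - f s x) <= 2 * L).
{ assert (H := Hlip y tau x s ltac:(lra) Hrt ltac:(lra) Hrs).
  rewrite (dsym y x), (Rabs_minus_sym tau s) in H.
  assert (L * (d x y + Rabs (s - tau)) <= L * 2) by (apply Rmult_le_compat_l; lra).
  lra. }
assert (Hprod : forall a b A B, Rabs a <= A -> Rabs b <= B -> - (A * B) <= a * b <= A * B).
{ intros a b A B Ha Hb; apply Rabs_le_between; rewrite Rabs_mult.
  apply Rmult_le_compat; auto using Rabs_pos. }
assert (H1 := Hprod _ _ _ _ Hst' Hf2).
assert (H2 := Hprod _ _ _ _ Hst Hf3).
assert (Hdx : d x y ^ 2 <= G x s y tau + 4 * L * delta) by (unfold G; lra).
assert (Hlh : lam * h * d x y ^ 2 <= lam * h * (G x s y tau + 4 * L * delta)).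
{ apply Rmult_le_compat_l; nra. }
assert (HC0 : 0 <= C) by nra.
assert (Hhd : C * h ^ 2 <= C * (h * delta)).
{ apply Rmult_le_compat_l; nra. }
assert (Hf1' : 2 * h * (f tau y - f s y) <= 2 * h * (L * delta)).
{ apply Rmult_le_compat_l; lra. }
assert (Hnew : G x' (s + h) y tau <= (1 + lam * h) * G x s y tau + K * delta * h).
{ unfold G in *; unfold K; lra. }
assert (HK : 0 <= K).
{ unfold K; assert (0 <= L * (2 * L + 4)) by nra; assert (0 <= lam * L) by nra; lra. }
assert (HGK : 0 <= G x s y tau + K * delta).
{ assert (0 <= d x y ^ 2) by apply pow2_ge_0.
  assert (4 * L <= K).
  { unfold K; assert (0 <= L * (2 * L + 4)) by nra; assert (L <= lam * L) by nra; lra. }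
  assert (4 * L * delta <= K * delta) by (apply Rmult_le_compat_r; lra).
  lra. }
assert (Hexp : (1 + lam * h) * (G x s y tau + K * delta) <=
   exp (lam * h) * (G x s y tau + K * delta)).
{ apply Rmult_le_compat_r; auto; apply exp_ineq1_le. }
assert (K * delta * h <= lam * h * (K * delta)).
{ assert (0 <= K * delta * h) by (apply Rmult_le_pos; nra). nra. }
lra.
Qed.

(** Induction on the total number of steps, removing the last step of the chain that is ahead in
    time. That step has length at most [delta], so the time lag stays at most [delta]. Each chain
    contributes its own exponential factor. *)
Lemma chain_compare delta N n m x s y tau : 0 < delta <= 1 -> (n + m <= N)%nat ->
  chain delta n p0 t0 x s -> chain delta m p0 t0 y tau ->
  Rabs (s - tau) <= delta -> s <= t0 + T -> tau <= t0 + T ->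
  G x s y tau + K * delta <= K * delta * (exp (lam * (s - t0)) * exp (lam * (tau - t0))).
Proof.
intros Hd; revert n m x s y tau.
assert (Hdiag : G p0 t0 p0 t0 + K * delta <=
  K * delta * (exp (lam * (t0 - t0)) * exp (lam * (t0 - t0)))).
{ unfold G; rewrite d_self, (Rminus_diag t0), !Rmult_0_r, exp_0; lra. }
induction N as [|N IH]; intros n m x s y tau HN Hx Hy Hst Hs Ht.
{ assert (n = 0%nat) by lia; assert (m = 0%nat) by lia; subst.
  inversion Hx; subst; inversion Hy; subst.
  exact Hdiag. }
assert (Hmain : forall n m x s y tau, (n + m <= S N)%nat ->
  chain delta n p0 t0 x s -> chain delta m p0 t0 y tau ->
  Rabs (s - tau) <= delta -> s <= t0 + T -> tau <= t0 + T -> tau <= s ->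
  G x s y tau + K * delta <= K * delta * (exp (lam * (s - t0)) * exp (lam * (tau - t0)))).
{ clear n m x s y tau HN Hx Hy Hst Hs Ht.
  intros n m x s y tau HN Hx Hy Hst Hs Ht Hts.
  assert (Ht0 := chain_time _ _ _ _ _ _ Hy).
  assert (Hball : forall n x s, chain delta n p0 t0 x s -> s <= t0 + T -> d p0 x <= r / 8).
  { intros n' x' s' H' Hs'; apply chain_dist in H'; nra. }
  inversion Hx as [x1 s1|n1 x1 s1 x2 s2 x3 h Hx2 Hh He]; subst.
  (* If the chain that is ahead has no steps, both times equal [t0], and the other chain is empty
     because steps have positive length. *)
  - assert (tau = s) by lra; subst tau.
    inversion Hy as [x1 s1|n1 x1 s1 x2 s2 x3 h Hx2 Hh He]; subst.
    + exact Hdiag.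
    + apply chain_time in Hx2; lra.
  - apply Rabs_le_between in Hst as Hst'.
    assert (Hs2 := chain_time _ _ _ _ _ _ Hx2).
    assert (Hst2 : Rabs (s2 - tau) <= delta) by (apply Rabs_le; lra).
    assert (IH2 := IH n1 m x2 s2 y tau ltac:(lia) Hx2 Hy Hst2 ltac:(lra) Ht).
    assert (Hstp := chain_compare_step delta x2 s2 x h y tau Hd Hh Hst2 Hst
      (Hball _ _ _ Hx2 ltac:(lra)) (Hball _ _ _ Hx Hs) (Hball _ _ _ Hy Ht)
      ltac:(lra) Hs ltac:(lra) He).
    apply (Rmult_le_compat_l (exp (lam * h))) in IH2; [|left; apply exp_pos].
    replace (lam * (s2 + h - t0)) with (lam * h + lam * (s2 - t0)) by ring.
    rewrite exp_plus; lra. }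
destruct (Rle_dec tau s) as [Hle|Hgt]; [eapply Hmain; eauto|].
assert (H := Hmain m n y tau x s ltac:(lia) Hy Hx ltac:(now rewrite Rabs_minus_sym)
  Ht Hs ltac:(lra)).
(* The symmetry of [G] under exchange of the two chains reduces this case to the previous one. *)
replace (G x s y tau) with (G y tau x s); [lra|].
unfold G; rewrite (dsym y x); ring.
Qed.

(** At equal times the correction term of [G] vanishes and [G] is the squared distance. *)
Lemma chain_sync_dist : exists K2, 0 < K2 /\
  forall delta n m x y t, 0 < delta <= 1 -> t <= t0 + T ->
    chain delta n p0 t0 x t -> chain delta m p0 t0 y t -> d x y ^ 2 <= K2 * delta.
Proof.
exists (K * (exp (lam * T) * exp (lam * T)) + 1).
assert (HK : 0 <= K).
{ unfold K; assert (0 <= L * (2 * L + 4)) by nra; assert (0 <= lam * L) by nra; nra. }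
assert (HeT : 0 < exp (lam * T)) by apply exp_pos.
split; [assert (0 <= K * (exp (lam * T) * exp (lam * T))) by (apply Rmult_le_pos; nra); lra|].
intros delta n m x y t Hd Ht Hx Hy.
assert (Habs : Rabs (t - t) <= delta) by (rewrite Rminus_diag, Rabs_R0; lra).
assert (H := chain_compare delta _ n m x t y t Hd (le_n _) Hx Hy Habs Ht Ht).
assert (Htt := chain_time _ _ _ _ _ _ Hx).
assert (He : 0 < exp (lam * (t - t0)) <= exp (lam * T)).
{ split; [apply exp_pos|].
  assert (Hle : lam * (t - t0) <= lam * T) by (apply Rmult_le_compat_l; lra).
  destruct Hle as [Hlt| ->]; [left; apply exp_increasing; auto|lra]. }
assert (Hee : exp (lam * (t - t0)) * exp (lam * (t - t0)) <= exp (lam * T) * exp (lam * T))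
  by (apply Rmult_le_compat; lra).
assert (HKd : 0 <= K * delta) by nra.
apply (Rmult_le_compat_l (K * delta)) in Hee; auto.
unfold G in H; rewrite Rminus_diag in H; lra.
Qed.

(** * Convergence of the chains *)

Lemma chain_limit t : complete d -> t0 <= t <= t0 + T ->
  exists q, forall e, 0 < e -> exists delta, 0 < delta <= 1 /\
    forall n y, chain delta n p0 t0 y t -> d y q < e.
Proof.
intros Hcompl Ht.
destruct chain_sync_dist as [K2 [HK2 Hsync]].
set (del := fun k => / (INR k + 1)).
assert (Hdel : forall k, 0 < del k <= 1).
{ intros k; assert (Hk := pos_INR k); unfold del; split; [apply Rinv_0_lt_compat; lra|].
  rewrite <- Rinv_1; apply Rinv_le_contravar; lra. }
assert (Hdelm : forall k m, (k <= m)%nat -> del m <= del k).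
{ intros k m Hkm; apply le_INR in Hkm; assert (Hk := pos_INR k).
  apply Rinv_le_contravar; lra. }
assert (Hsmall : forall e, 0 < e -> exists N, forall n m x y,
  chain (del N) n p0 t0 x t -> chain (del N) m p0 t0 y t -> d x y < e).
{ intros e He.
  destruct (INR_unbounded (K2 / e ^ 2)) as [N HN].
  assert (He2 : 0 < e ^ 2) by (apply pow_lt; auto).
  exists N; intros n m x y Hx Hy.
  assert (H := Hsync _ _ _ _ _ _ (Hdel N) (proj2 Ht) Hx Hy).
  assert (Hlt : K2 * del N < e ^ 2).
  { unfold del; assert (Hp := pos_INR N).
    apply Rmult_lt_reg_r with (INR N + 1); [lra|].
    rewrite Rmult_assoc, Rinv_l by lra.
    assert (K2 = K2 / e ^ 2 * e ^ 2) by (field; lra).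
    nra. }
  assert (Hxy := d_nonneg d Hm x y).
  apply Rnot_le_lt; intros Hge.
  assert (e ^ 2 <= d x y ^ 2) by (apply pow_incr; lra).
  lra. }
assert (Hpick : forall k, { y : X | exists n, chain (del k) n p0 t0 y t }).
{ intros k; apply constructive_indefinite_description.
  destruct (chain_reach (del k) p0 t0 t) as [n [y Hy]]; try lra.
  - apply Hdel.
  - rewrite d_self; nra.
  - exists y, n; auto. }
set (y := fun k => proj1_sig (Hpick k)).
assert (Hy : forall k, exists n, chain (del k) n p0 t0 (y k) t) by
  (intros k; apply (proj2_sig (Hpick k))).
assert (Hy' : forall N k, (N <= k)%nat -> exists n, chain (del N) n p0 t0 (y k) t).
{ intros N k HNk; destruct (Hy k) as [n Hn]; exists n; eapply chain_mono; eauto. }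
destruct (Hcompl y) as [q Hq].
{ intros e He; destruct (Hsmall e He) as [N HN]; exists N; intros m n Hm' Hn'.
  destruct (Hy' N m Hm') as [i Hi]; destruct (Hy' N n Hn') as [j Hj]; eauto. }
exists q; intros e He.
destruct (Hsmall (e / 2) ltac:(lra)) as [N HN].
exists (del N); split; auto; intros n x Hx.
destruct (Hq (e / 2) ltac:(lra)) as [N' HN'].
destruct (Hy' N (max N N') ltac:(lia)) as [m Hm'].
assert (H1 := HN _ _ _ _ Hx Hm').
assert (H2 := HN' (max N N') ltac:(lia)).
assert (H3 := dtri x (y (max N N')) q); lra.
Qed.

(** Moving [x] and [y] by [e] changes both conditions by a multiple of [e] that does not depend on
    [e], so they pass to the limit. *)
Lemma evi_step_closed x t y h :
  0 <= h <= 1 -> Rabs (t - t0) < r -> d p0 x <= r / 4 -> d p0 y <= r / 4 ->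
  (forall e, 0 < e -> exists x' y', d x' x < e /\ d y' y < e /\ evi_step C x' t y' h) ->
  evi_step C x t y h.
Proof.
intros Hh Ht Hx Hy Happ.
assert (Hlim : forall A B M, 0 <= M -> (forall e, 0 < e <= r / 16 -> A <= B + M * e) -> A <= B).
{ intros A B M HM H; apply Rnot_lt_le; intros Hlt.
  set (e := Rmin (r / 16) ((A - B) / 2 / (M + 1))).
  assert (He : 0 < e).
  { apply Rmin_pos; [lra|]; apply Rdiv_lt_0_compat; lra. }
  assert (H1 := Rmin_l (r / 16) ((A - B) / 2 / (M + 1))).
  assert (H2 := Rmin_r (r / 16) ((A - B) / 2 / (M + 1))); fold e in H1, H2.
  specialize (H e ltac:(lra)).
  assert ((M + 1) * e <= (A - B) / 2).
  { replace ((A - B) / 2) with ((M + 1) * ((A - B) / 2 / (M + 1))) by (field; lra).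
    apply Rmult_le_compat_l; lra. }
  lra. }
split.
{ apply Hlim with 2; [lra|]; intros e He.
  destruct (Happ e ltac:(lra)) as [x' [y' [Hx' [Hy' [Hd _]]]]].
  assert (H1 := dtri x x' y); assert (H2 := dtri x' y' y); rewrite (dsym x x') in H1.
  lra. }
intros z Hz.
apply Hlim with (4 + 2 * L + 2 * lam); [lra|]; intros e He.
destruct (Happ e ltac:(lra)) as [x' [y' [Hx' [Hy' [Hd H]]]]].
specialize (H z Hz).
assert (Hpx' : d p0 x' < r).
{ assert (H1 := dtri p0 x x'); rewrite (dsym x x') in H1; lra. }
assert (Hxz : d x z <= 3 * r / 8).
{ assert (H1 := dtri x p0 z); rewrite (dsym x p0) in H1; lra. }
assert (Hyz : d y z <= 3 * r / 8).
{ assert (H1 := dtri y p0 z); rewrite (dsym y p0) in H1; lra. }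
assert (Hsq : forall a b, 0 <= a <= 1 / 2 -> 0 <= b <= a + e -> b ^ 2 <= a ^ 2 + 2 * e).
{ intros a b Ha Hb; assert (b ^ 2 <= (a + e) ^ 2) by (apply pow_incr; lra); nra. }
assert (H1 : d x' z ^ 2 <= d x z ^ 2 + 2 * e).
{ apply Hsq; split; try apply dnn; try lra; assert (H1 := dtri x' x z); lra. }
assert (H2 : d y z ^ 2 <= d y' z ^ 2 + 2 * e).
{ assert (Hyy := dtri y y' z); rewrite (dsym y y') in Hyy.
  assert (Hyy' := dtri y' y z).
  apply Hsq; split; try apply dnn; lra. }
assert (H3 : f t x' - f t x <= L * (e + 0)).
{ apply f_diff_le; auto; try lra; rewrite Rminus_diag, Rabs_R0; lra. }
assert (H4 : 2 * h * (f t x' - f t x) <= 2 * (L * e)).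
{ assert (0 <= L * e) by nra. nra. }
assert (H5 : lam * h * d x' z ^ 2 <= lam * h * (d x z ^ 2 + 2 * e)).
{ apply Rmult_le_compat_l; nra. }
assert (H6 : lam * h * (2 * e) <= lam * (2 * e)).
{ assert (0 <= lam * e) by nra; nra. }
lra.
Qed.

(** The limits are chosen separately at each time. They fit together because all chains of small
    mesh reaching a given time are close to the same limit, whatever their intermediate points. *)
Lemma local_flow : complete d -> exists u : R -> X, u t0 = p0 /\
  forall s t, t0 <= s -> s <= t -> t <= t0 + T -> evi_step C (u s) s (u t) (t - s).
Proof.
intros Hcompl.
assert (Hpick : forall t, { q : X | t0 <= t <= t0 + T ->
  forall e, 0 < e -> exists delta, 0 < delta <= 1 /\
    forall n y, chain delta n p0 t0 y t -> d y q < e }).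
{ intros t; apply constructive_indefinite_description.
  destruct (classic (t0 <= t <= t0 + T)) as [Ht|Ht].
  - destruct (chain_limit t Hcompl Ht) as [q Hq]; exists q; auto.
  - exists p0; intros; tauto. }
set (u := fun t => proj1_sig (Hpick t)).
assert (Hu : forall t, t0 <= t <= t0 + T ->
  forall e, 0 < e -> exists delta, 0 < delta <= 1 /\
    forall n y, chain delta n p0 t0 y t -> d y (u t) < e) by
  (intros t; apply (proj2_sig (Hpick t))).
(* A fine chain to time [s] is prolonged to time [t]: its intermediate point is close to [u s], its
   end to [u t], and the second piece is a step of length [t - s]. *)
assert (Happ : forall s t e, t0 <= s -> s <= t -> t <= t0 + T -> 0 < e ->
  exists x y, d x (u s) < e /\ d y (u t) < e /\ evi_step C x s y (t - s) /\
    d p0 x <= r / 8 /\ d p0 y <= r / 8).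
{ intros s t e Hs Hst Ht He.
  destruct (Hu s ltac:(lra) e He) as [d1 [Hd1 H1]].
  destruct (Hu t ltac:(lra) e He) as [d2 [Hd2 H2]].
  set (del := Rmin d1 d2).
  assert (Hdel : 0 < del) by (apply Rmin_pos; lra).
  destruct (chain_reach del p0 t0 s) as [n [x Hx]]; try lra.
  { rewrite d_self; nra. }
  assert (Hpx := chain_dist _ _ _ _ _ _ Hx).
  destruct (chain_reach del x s t) as [m [y Hy]]; try lra.
  { nra. }
  assert (Hpy := chain_dist _ _ _ _ _ _ (chain_app _ _ _ _ _ _ _ _ _ Hx Hy)).
  exists x, y; repeat split.
  - apply (H1 n); eapply chain_mono; eauto; apply Rmin_l.
  - apply (H2 (n + m)%nat); eapply chain_mono; [apply Rmin_r|].
    eapply chain_app; eauto.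
  - eapply proj1, chain_evi; eauto; nra.
  - eapply proj2, chain_evi; eauto; nra.
  - nra.
  - nra. }
exists u; split.
(* The empty chain is admissible for every mesh and ends at [p0]. *)
- apply (d_eq0 d Hm); apply Rle_antisym; [|apply dnn].
  apply Rnot_lt_le; intros Hlt.
  destruct (Hu t0 ltac:(lra) _ Hlt) as [d1 [Hd1 H1]].
  specialize (H1 _ _ (chain_nil _ _ _)); rewrite dsym in H1; lra.
- intros s t Hs Hst Ht.
  apply evi_step_closed; try nra.
  + apply time_in_range; lra.
  + destruct (Happ s t (r / 8) Hs Hst Ht ltac:(lra)) as [x [y [Hx [_ [_ [Hpx _]]]]]].
    assert (H := dtri p0 x (u s)); lra.
  + destruct (Happ s t (r / 8) Hs Hst Ht ltac:(lra)) as [x [y [_ [Hy [_ [_ Hpy]]]]]].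
    assert (H := dtri p0 y (u t)); lra.
  + intros e He; destruct (Happ s t e Hs Hst Ht He) as [x [y [Hx [Hy [Hxy _]]]]].
    exists x, y; auto.
Qed.

End LocalFlow.

(** * From the variational inequality to gradient curves *)

(** The inequality from [t] to [t + eps] is tested at a point [z] of the geodesic at distance [s]
    from [u t], where [s] is chosen before [eps]. The triangle inequality through [z] then carries
    the bound from [z] to [p]. *)
Lemma evi_flow_gradient {X : Type} (d : X -> X -> R) (f : R -> X -> R)
    (p0 : X) (t0 r L lam C T : R) (u : R -> X) (t : R) (p : X) (sigma : R -> X) (D : R) :
  is_metric d -> 1 <= lam -> 0 <= C -> 0 <= L -> (2 * L + 2) * T <= r / 8 ->
  u t0 = p0 ->
  (forall s t, t0 <= s -> s <= t -> t <= t0 + T ->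
     evi_step d f p0 r L lam C (u s) s (u t) (t - s)) ->
  t0 <= t < t0 + T -> p <> u t -> geodesic_between d sigma (u t) p ->
  right_deriv (f t) (u t) sigma D ->
  forall e, 0 < e -> exists delta, 0 < delta /\
    forall eps, 0 < eps < delta -> t + eps < t0 + T ->
      d p (u (t + eps)) <= d p (u t) - eps * D + e * eps.
Proof.
intros Hm Hlam HC HL HTr Hu0 Hu Ht Hp [Hsig [Hs0 Hsl]] HD e He.
set (q := u t) in *; set (l := d q p) in *.
assert (Hl : 0 < l).
{ destruct (d_nonneg d Hm q p) as [H|H]; auto.
  symmetry in H; apply (d_eq0 d Hm) in H; congruence. }
assert (Hpq : d p0 q < r / 8).
{ destruct (Hu t0 t) as [H _]; try lra; rewrite Hu0 in H; fold q in H; nra. }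
destruct (HD (e / 4) ltac:(lra)) as [d1 [Hd1 Hq]].
(* The four bounds put [z] on the geodesic, make it an admissible test point, bring the difference
   quotient within [e / 4] of [D], and give [lam * s <= e / 2]. *)
set (s := Rmin (Rmin l (r / 8 - d p0 q)) (Rmin (d1 / 2) (e / (2 * lam)))).
assert (Hels : 0 < e / (2 * lam)) by (apply Rdiv_lt_0_compat; lra).
assert (Hs : 0 < s) by (repeat apply Rmin_pos; lra).
assert (Hs12 : s <= l /\ s <= r / 8 - d p0 q /\ s <= d1 / 2 /\ s <= e / (2 * lam)).
{ assert (H1 := Rmin_l (Rmin l (r / 8 - d p0 q)) (Rmin (d1 / 2) (e / (2 * lam)))).
  assert (H2 := Rmin_r (Rmin l (r / 8 - d p0 q)) (Rmin (d1 / 2) (e / (2 * lam)))).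
  assert (H3 := Rmin_l l (r / 8 - d p0 q)); assert (H4 := Rmin_r l (r / 8 - d p0 q)).
  assert (H5 := Rmin_l (d1 / 2) (e / (2 * lam))).
  assert (H6 := Rmin_r (d1 / 2) (e / (2 * lam))).
  fold s in H1, H2; repeat split; lra. }
destruct Hs12 as [Hsl' [Hsr [Hsd Hse]]].
assert (Hlams : lam * s <= e / 2).
{ replace (e / 2) with (lam * (e / (2 * lam))) by (field; lra).
  apply Rmult_le_compat_l; lra. }
set (z := sigma s).
assert (Hqz : d q z = s).
{ rewrite <- Hs0; unfold z; rewrite Hsig by lra; rewrite Rabs_left1; lra. }
assert (Hzp : d p z = l - s).
{ rewrite <- Hsl; unfold z; rewrite Hsig by lra; rewrite Rabs_pos_eq; lra. }
assert (Hpz : d p0 z <= r / 8) by (assert (H := d_tri d Hm p0 q z); lra).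
assert (Hfz : f t q - f t z <= s * (- D + e / 4)).
{ specialize (Hq s ltac:(lra)); apply Rabs_lt_between in Hq; fold z in Hq.
  replace (f t q - f t z) with (s * (- ((f t z - f t q) / s))) by (field; lra).
  apply Rmult_le_compat_l; lra. }
exists (s * e / (C + 1)); split.
{ apply Rdiv_lt_0_compat; nra. }
intros eps Heps Hte.
destruct (Hu t (t + eps)) as [_ H]; try lra.
specialize (H z Hpz); fold q in H; rewrite Hqz in H.
replace (t + eps - t) with eps in H by ring.
set (y := d (u (t + eps)) z) in *.
assert (HCe : C * eps <= s * e).
{ assert ((C + 1) * eps <= s * e); [|lra].
  replace (s * e) with ((C + 1) * (s * e / (C + 1))) by (field; lra).
  apply Rmult_le_compat_l; lra. }
assert (H1 : C * eps ^ 2 <= s * e * eps) by nra.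
assert (H2 : lam * eps * s ^ 2 <= e / 2 * (eps * s)).
{ replace (lam * eps * s ^ 2) with (lam * s * (eps * s)) by ring.
  apply Rmult_le_compat_r; nra. }
assert (H3 : 2 * eps * (f t q - f t z) <= 2 * eps * (s * (- D + e / 4))).
{ apply Rmult_le_compat_l; lra. }
assert (Hy : y <= s - eps * D + e * eps).
(* The square is linearised by [2 * s * y <= y ^ 2 + s ^ 2]; the three errors add up as
   [e / 4 + e / 4 + e / 2]. *)
{ apply Rmult_le_reg_l with (2 * s); [lra|].
  assert (0 <= (y - s) ^ 2) by apply pow2_ge_0.
  lra. }
assert (Htr := d_tri d Hm p z (u (t + eps))).
rewrite (d_sym d Hm z) in Htr; fold y in Htr.
rewrite (d_sym d Hm p q); fold l; lra.
Qed.

(** By concavity the corrected quotients [Q] decrease in the distance, and the Lipschitz bound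
    limits them from above. Their supremum is therefore their limit at 0, and it is at least
    [Q l]. *)
Lemma right_deriv_exists {X : Type} (d : X -> X -> R) (g : X -> R) (D : X -> Prop)
    (lam L l : R) (sigma : R -> X) :
  1 <= lam -> 0 < l -> lambda_concave_on d g D lam ->
  unit_geodesic_on d sigma 0 l -> (forall u, 0 <= u <= l -> D (sigma u)) ->
  (forall u, 0 <= u <= l -> g (sigma u) - g (sigma 0) <= L * u) ->
  exists v, right_deriv g (sigma 0) sigma v /\
    g (sigma l) - g (sigma 0) - lam / 2 * l ^ 2 <= l * v.
Proof.
intros Hlam Hl Hg Hsig HD HL.
set (Q := fun s => (g (sigma s) - g (sigma 0)) / s - lam / 2 * s).
assert (HQ : forall s l', 0 < s <= l' -> l' <= l -> Q l' <= Q s).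
{ intros s l' Hs Hl'.
  assert (H := lambda_concave_on_geodesic d g D lam sigma l' s Hg ltac:(lra) ltac:(lra)).
  assert (H' := H (fun a b Ha Hb => Hsig a b ltac:(lra) ltac:(lra))
    (fun u Hu => HD u ltac:(lra))).
  unfold Q; apply Rmult_le_reg_l with (l' * s); [nra|].
  replace (l' * s * ((g (sigma l') - g (sigma 0)) / l' - lam / 2 * l')) with
    (s * (g (sigma l') - g (sigma 0)) - l' * s * (lam / 2 * l')) by (field; lra).
  replace (l' * s * ((g (sigma s) - g (sigma 0)) / s - lam / 2 * s)) with
    (l' * (g (sigma s) - g (sigma 0)) - l' * s * (lam / 2 * s)) by (field; lra).
  lra. }
destruct (completeness (fun v => exists s, 0 < s <= l /\ v = Q s)) as [v [Hub Hlub]].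
- exists L; intros w [s [Hs ->]]; unfold Q.
  assert ((g (sigma s) - g (sigma 0)) / s <= L).
  { apply Rmult_le_reg_r with s; [lra|].
    unfold Rdiv; rewrite Rmult_assoc, Rinv_l, Rmult_1_r by lra; apply HL; lra. }
  assert (0 <= lam / 2 * s) by nra; lra.
- exists (Q l), l; split; [lra|auto].
- exists v; split.
  + intros e He.
    assert (Hex : exists s, 0 < s <= l /\ v - e / 2 < Q s).
    { apply NNPP; intros Hno.
      assert (v <= v - e / 2); [|lra].
      apply Hlub; intros w [s [Hs ->]]; apply Rnot_lt_le; intros Hlt.
      apply Hno; exists s; auto. }
    destruct Hex as [s [Hs HQs]].
    exists (Rmin s (e / lam)).
    assert (Hel : 0 < e / lam) by (apply Rdiv_lt_0_compat; lra).
    split; [apply Rmin_pos; lra|].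
    intros eps Heps.
    assert (H1 := Rmin_l s (e / lam)); assert (H2 := Rmin_r s (e / lam)).
    assert (Hle : lam * eps < e).
    { replace e with (lam * (e / lam)) by (field; lra).
      apply Rmult_lt_compat_l; lra. }
    assert (H3 := HQ eps s ltac:(lra) ltac:(lra)).
    assert (H4 : Q eps <= v) by (apply Hub; exists eps; split; [lra|auto]).
    replace ((g (sigma eps) - g (sigma 0)) / eps) with (Q eps + lam / 2 * eps)
      by (unfold Q; ring).
    apply Rabs_lt_between; nra.
  + assert (H : Q l <= v) by (apply Hub; exists l; split; [lra|auto]).
    apply (Rmult_le_compat_l l) in H; [|lra].
    replace (l * Q l) with (g (sigma l) - g (sigma 0) - lam / 2 * l ^ 2) in H
      by (unfold Q; field; lra).
    lra.
Qed.

(** * A Gronwall inequality for Dini derivatives *)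

(** By completeness, the initial segment on which [P] holds can only end at [b]. *)
Lemma real_induction (P : R -> Prop) (a b : R) : a <= b -> P a ->
  (forall t, a <= t < b -> P t ->
     exists delta, 0 < delta /\ forall s, t < s < t + delta -> s <= b -> P s) ->
  (forall t, a < t <= b -> (forall s, a <= s < t -> P s) -> P t) ->
  P b.
Proof.
intros Hab Ha Hopen Hclosed.
destruct (completeness (fun t => a <= t <= b /\ forall s, a <= s <= t -> P s))
  as [m [Hub Hlub]].
- exists b; intros t [Ht _]; lra.
- exists a; split; [lra|]; intros s Hs; replace s with a by lra; auto.
- assert (Ham : a <= m).
  { apply Hub; split; [lra|]; intros s Hs; replace s with a by lra; auto. }
  assert (Hmb : m <= b) by (apply Hlub; intros t [Ht _]; lra).
  assert (Hlt : forall s, a <= s < m -> P s).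
  { intros s Hs; apply NNPP; intros Hno.
    assert (m <= s); [|lra].
    apply Hlub; intros t [Ht HPt]; apply Rnot_lt_le; intros Hst.
    apply Hno, HPt; lra. }
  assert (HPm : P m).
  { destruct (Req_dec a m) as [<-|Hne]; auto; apply Hclosed; auto; lra. }
  destruct (Req_dec m b) as [<-|Hne]; auto; exfalso.
  destruct (Hopen m ltac:(lra) HPm) as [delta [Hd Hs]].
  set (t := Rmin b (m + delta / 2)).
  assert (Ht : m < t) by (apply Rmin_glb_lt; lra).
  assert (H1 := Rmin_l b (m + delta / 2)); assert (H2 := Rmin_r b (m + delta / 2)).
  fold t in H1, H2.
  assert (t <= m); [|lra].
  apply Hub; split; [lra|]; intros s Hst.
  destruct (Rlt_le_dec s m) as [Hsm|[Hsm|Hsm]]; [apply Hlt; lra | apply Hs; lra|].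
  now subst.
Qed.

(** The first condition excludes upward jumps from the left; the second bounds the upper right
    derivative by [K * g]. Real induction compares [g] with [e * exp ((K + 1) * (t - a))], whose
    extra rate 1 absorbs the error [e * eps], and [e] is arbitrary. *)
Lemma gronwall_dini (g : R -> R) (a b K : R) : 0 <= K -> a <= b -> g a <= 0 ->
  (forall t, a < t <= b -> forall e, 0 < e -> exists delta, 0 < delta /\
     forall s, a <= s < t -> t - delta < s -> g t <= g s + e) ->
  (forall t, a <= t < b -> forall e, 0 < e -> exists delta, 0 < delta /\
     forall eps, 0 < eps < delta -> t + eps <= b ->
       g (t + eps) <= g t + K * eps * g t + e * eps) ->
  g b <= 0.
Proof.
intros HK Hab Ha Hleft Hdini.
assert (Hmain : forall e, 0 < e -> g b <= e * exp ((K + 1) * (b - a))).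
{ intros e He.
  apply (real_induction (fun t => g t <= e * exp ((K + 1) * (t - a))) a b); auto.
  - rewrite Rminus_diag, Rmult_0_r, exp_0; lra.
  - intros t Ht Hgt; destruct (Hdini t Ht e He) as [delta [Hd H]].
    exists delta; split; auto; intros s Hs Hsb.
    specialize (H (s - t) ltac:(lra) ltac:(lra)).
    replace (t + (s - t)) with s in H by ring.
    replace ((K + 1) * (s - a)) with ((K + 1) * (t - a) + (K + 1) * (s - t)) by ring.
    rewrite exp_plus.
    set (E := exp ((K + 1) * (t - a))) in *.
    assert (HE : 1 <= E).
    { assert (H1 := exp_ineq1_le ((K + 1) * (t - a))); fold E in H1; nra. }
    assert (H1 := exp_ineq1_le ((K + 1) * (s - t))).
    assert (H2 : K * (s - t) * g t <= K * (s - t) * (e * E)).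
    { apply Rmult_le_compat_l; nra. }
    assert (H3 : e * E * (1 + (K + 1) * (s - t)) <= e * E * exp ((K + 1) * (s - t))).
    { apply Rmult_le_compat_l; nra. }
    assert (H4 : e * (s - t) <= e * E * (s - t)) by (apply Rmult_le_compat_r; nra).
    lra.
  - intros t Ht Hlt; apply Rnot_lt_le; intros Hgt.
    set (B := e * exp ((K + 1) * (t - a))) in *.
    destruct (Hleft t Ht ((g t - B) / 2) ltac:(lra)) as [delta [Hd H]].
    set (s := Rmax a (t - delta / 2)).
    assert (H1 := Rmax_l a (t - delta / 2)); assert (H2 := Rmax_r a (t - delta / 2)).
    assert (H3 : s < t) by (apply Rmax_lub_lt; lra).
    fold s in H1, H2.
    specialize (H s ltac:(lra) ltac:(lra)); specialize (Hlt s ltac:(lra)).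
    assert (e * exp ((K + 1) * (s - a)) <= B).
    { apply Rmult_le_compat_l; [lra|]; left; apply exp_increasing; nra. }
    lra. }
apply Rnot_lt_le; intros Hgt.
set (E := exp ((K + 1) * (b - a))) in *.
assert (HE : 0 < E) by apply exp_pos.
specialize (Hmain (g b / 2 / E)).
replace (g b / 2 / E * E) with (g b / 2) in Hmain by (field; lra).
assert (0 < g b / 2 / E) by (apply Rdiv_lt_0_compat; lra).
lra.
Qed.

(** * Uniqueness and maximal curves *)

Lemma gradient_curve_restrict {X : Type} (d : X -> X -> R) Omega f alpha a a' c c' :
  (forall t, in_Ico a' c' t -> in_Ico a c t) ->
  gradient_curve d Omega f alpha a c -> gradient_curve d Omega f alpha a' c'.
Proof.
intros Hsub [[L HL] [HO Hg]]; split; [|split].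
- exists L; intros s t Hs Ht; apply HL; auto.
- auto.
- intros t p sigma D Ht Hp Hsig HD e He.
  destruct (Hg t p sigma D (Hsub t Ht) Hp Hsig HD e He) as [delta [Hd H]].
  exists delta; split; auto.
Qed.

Lemma gradient_curve_lipschitz {X : Type} (d : X -> X -> R) Omega f alpha a c :
  gradient_curve d Omega f alpha a c -> exists M, 0 <= M /\
  forall s t, in_Ico a c s -> in_Ico a c t -> d (alpha s) (alpha t) <= M * Rabs (s - t).
Proof.
intros [[L HL] _]; exists (Rabs L); split; [apply Rabs_pos|].
intros s t Hs Ht; eapply Rle_trans; [apply HL; auto|].
apply Rmult_le_compat_r; [apply Rabs_pos|apply RRle_abs].
Qed.

(** * Local existence and uniqueness of gradient curves *)

Section GradientFlow.

Context {X : Type} (d : X -> X -> R) (kappa : R).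
Context (Omega : X -> R -> Prop) (f : R -> X -> R) (L : R).
Hypothesis Hm : is_metric d.
Hypothesis Hcompl : complete d.
Hypothesis Hcat : CAT kappa d.
Hypothesis Hsc : locally_semiconcave d Omega f.
Hypothesis HL : 0 <= L.
Hypothesis Hlip : forall x t y s, Omega x t -> Omega y s ->
  Rabs (f t x - f s y) <= L * (d x y + Rabs (t - s)).

Lemma local_data p0 t0 : Omega p0 t0 -> exists r lam K, 0 < r <= 1 /\ 1 <= lam /\ 0 <= K /\
  (forall y s, d p0 y < r -> Rabs (s - t0) < r -> Omega y s) /\
  (forall t, Rabs (t - t0) < r -> lambda_concave_on d (f t) (fun x => d p0 x < r) lam) /\
  cat_estimate kappa (2 * L + 2) r K.
Proof.
intros HO.
destruct (Hsc p0 t0 HO) as [O' [r1 [lam [Hr1 [HO' [HOO Hconc]]]]]].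
destruct (cat_estimate_exists kappa (2 * L + 2) ltac:(lra)) as [r0 [K [Hr0 [HK Hest]]]].
set (r := Rmin 1 (Rmin r0 r1)).
assert (H1 := Rmin_l 1 (Rmin r0 r1)); assert (H2 := Rmin_r 1 (Rmin r0 r1)).
assert (H3 := Rmin_l r0 r1); assert (H4 := Rmin_r r0 r1); fold r in H1, H2.
assert (Hr : 0 < r) by (repeat apply Rmin_pos; lra).
exists r, (Rmax 1 lam), K.
split; [lra|]; split; [apply Rmax_l|]; split; [auto|].
split; [|split].
- intros y s Hy Hs; apply HOO, HO'; lra.
- intros t Ht; apply (lambda_concave_on_le d (f t) (fun x => O' x t) _ lam); auto.
  + apply Rmax_r.
  + intros x Hx; apply HO'; lra.
- apply Hest; lra.
Qed.

Lemma local_existence p0 t0 : Omega p0 t0 -> exists T u, 0 < T /\ u t0 = p0 /\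
  gradient_curve d Omega f u t0 (Some (t0 + T)) /\
  forall s t, t0 <= s -> s <= t -> t <= t0 + T -> d (u s) (u t) <= (2 * L + 2) * (t - s).
Proof.
intros HO.
destruct (local_data p0 t0 HO) as [r [lam [K [Hr [Hlam [HK [HOr [Hconc Hest]]]]]]]].
assert (Hlip' : forall x t y s,
  d p0 x < r -> Rabs (t - t0) < r -> d p0 y < r -> Rabs (s - t0) < r ->
  Rabs (f t x - f s y) <= L * (d x y + Rabs (t - s))) by auto.
destruct (evi_step_exists d f p0 t0 r L lam Hm Hr HL Hlam Hlip' kappa Hcat Hconc)
  as [C0 [h0 [Hh0 Hstep]]]; [eauto|].
(* The maximum makes [C] large enough both for steps to exist and for them to compose. *)
set (C := Rmax C0 (L * (2 * L + 4) + lam * (2 * L + 2))).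
set (T := r / 8 / (2 * L + 2)).
assert (HTr : (2 * L + 2) * T = r / 8) by (unfold T; field; lra).
assert (HT : 0 < T) by (repeat apply Rdiv_lt_0_compat; lra).
assert (HC : L * (2 * L + 4) + lam * (2 * L + 2) <= C) by apply Rmax_r.
destruct (local_flow d f p0 t0 r L lam Hm Hr HL Hlam Hlip' C h0 T HC Hh0 HT
  (Req_le _ _ HTr)) as [u [Hu0 Hu]]; auto.
{ intros x t h Hx Ht Hh; apply Hstep; auto; apply Rmax_l. }
exists T, u; split; [auto|]; split; [auto|]; split; [split; [|split]|].
- exists (2 * L + 2); unfold in_Ico; intros s t Hs Ht.
  destruct (Rle_dec s t) as [Hle|Hgt].
  + rewrite Rabs_left1 by lra; destruct (Hu s t) as [H _]; lra.
  + rewrite (d_sym d Hm), Rabs_pos_eq by lra; destruct (Hu t s) as [H _]; lra.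
- unfold in_Ico; intros t Ht; destruct (Hu t0 t) as [H _]; try lra; rewrite Hu0 in H.
  assert (t - t0 < r) by nra.
  apply HOr; [nra|rewrite Rabs_pos_eq; lra].
- unfold in_Ico; intros t p sigma D Ht Hp Hsig HD e He.
  destruct (evi_flow_gradient d f p0 t0 r L lam C T u t p sigma D Hm Hlam ltac:(nra) HL
    (Req_le _ _ HTr) Hu0 Hu ltac:(lra) Hp Hsig HD e He) as [delta [Hd H]].
  exists delta; split; auto; intros eps Heps [_ Hte]; auto.
- intros s t Hs Hst Ht; apply Hu; auto.
Qed.

(* Concavity bounds each of the two directional derivatives of [f t] along [x y] from
   below by the opposite difference quotients, so these cancel in the sum. *)
Lemma directional_derivatives_sum p0 t0 r lam K x y t :
  0 < r <= 1 -> 1 <= lam ->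
  (forall z s, d p0 z < r -> Rabs (s - t0) < r -> Omega z s) ->
  (forall t, Rabs (t - t0) < r -> lambda_concave_on d (f t) (fun x => d p0 x < r) lam) ->
  cat_estimate kappa (2 * L + 2) r K ->
  d p0 x <= r / 4 -> d p0 y <= r / 4 -> x <> y -> Rabs (t - t0) < r ->
  exists m sigma tau D1 D2,
    geodesic_between d sigma x m /\ geodesic_between d tau y m /\ m <> x /\ m <> y /\
    d x m + d m y = d x y /\
    right_deriv (f t) x sigma D1 /\ right_deriv (f t) y tau D2 /\
    - (lam * d x y) <= D1 + D2.
Proof.
intros Hr Hlam HO Hconc [Hvarpi _] Hx Hy Hxy Ht.
set (l := d x y).
assert (Hl : 0 < l).
{ destruct (d_nonneg d Hm x y) as [H|H]; auto.
  symmetry in H; apply (d_eq0 d Hm) in H; congruence. }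
assert (Hlr : l <= r / 2).
{ assert (H := d_tri d Hm x p0 y); rewrite (d_sym d Hm x p0) in H; unfold l; lra. }
destruct (proj1 Hcat x y) as [sigma [Hsig [Hs0 Hsl]]]; [apply Hvarpi; fold l; lra|].
fold l in Hsig, Hsl.
set (tau := fun s => sigma (l - s)).
assert (Htau : unit_geodesic_on d tau 0 l).
{ intros u v Hu Hv; unfold tau; rewrite Hsig by lra.
  rewrite Rabs_minus_sym; f_equal; ring. }
assert (Ht0 : tau 0 = y) by (unfold tau; rewrite Rminus_0_r; auto).
assert (Htl : tau l = x) by (unfold tau; rewrite Rminus_diag; auto).
assert (Hball : forall u, 0 <= u <= l -> d p0 (sigma u) < r).
{ intros u Hu; assert (H := d_tri d Hm p0 x (sigma u)).
  assert (Hxu : d x (sigma u) = Rabs (0 - u)).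
  { rewrite <- Hs0 at 1; apply Hsig; lra. }
  rewrite Rabs_left1 in Hxu; lra. }
assert (Hball' : forall u, 0 <= u <= l -> d p0 (tau u) < r).
{ intros u Hu; apply Hball; lra. }
assert (HLs : forall rho, unit_geodesic_on d rho 0 l ->
  (forall u, 0 <= u <= l -> d p0 (rho u) < r) ->
  forall u, 0 <= u <= l -> f t (rho u) - f t (rho 0) <= L * u).
{ intros rho Hrho Hb u Hu.
  assert (H := Hlip (rho u) t (rho 0) t (HO _ _ (Hb u Hu) Ht)
    (HO _ _ (Hb 0 ltac:(lra)) Ht)).
  rewrite Hrho, Rminus_diag, Rabs_R0, Rminus_0_r, (Rabs_pos_eq u) in H by lra.
  apply Rabs_le_between in H; lra. }
destruct (right_deriv_exists d (f t) _ lam L l sigma Hlam Hl (Hconc t Ht) Hsig Hball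
  (HLs sigma Hsig Hball)) as [D1 [HD1 Hl1]].
destruct (right_deriv_exists d (f t) _ lam L l tau Hlam Hl (Hconc t Ht) Htau Hball'
  (HLs tau Htau Hball')) as [D2 [HD2 Hl2]].
rewrite Hs0 in HD1, Hl1; rewrite Hsl in Hl1; rewrite Ht0 in HD2, Hl2; rewrite Htl in Hl2.
(* A right derivative only sees the start of a geodesic, so the derivatives along the whole of
   [sigma] and [tau] also serve for their halves ending at the midpoint. *)
set (m := sigma (l / 2)).
assert (Hxm : d x m = l / 2).
{ rewrite <- Hs0 at 1; unfold m; rewrite Hsig by lra; rewrite Rabs_left1; lra. }
assert (Hym : d y m = l / 2).
{ rewrite <- Hsl at 1; unfold m; rewrite Hsig by lra; rewrite Rabs_pos_eq; lra. }
exists m, sigma, tau, D1, D2; repeat match goal with |- _ /\ _ => split end; auto.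
- unfold geodesic_between; rewrite Hxm; repeat split; auto.
  intros u v Hu Hv; apply Hsig; lra.
- unfold geodesic_between; rewrite Hym; repeat split; auto.
  + intros u v Hu Hv; apply Htau; lra.
  + unfold tau, m; f_equal; lra.
- intros ->; rewrite (proj2 (d_eq0 d Hm x x) eq_refl) in Hxm; lra.
- intros ->; rewrite (proj2 (d_eq0 d Hm y y) eq_refl) in Hym; lra.
- rewrite (d_sym d Hm m y); lra.
- apply Rmult_le_reg_l with l; auto; nra.
Qed.

(** Gronwall's inequality is applied to the squared distance. Where the curves meet there is no
    direction to differentiate in, but the distance grows at most linearly from 0, so its square is
    negligible to first order. *)
Lemma local_uniqueness alpha beta a b : a < b -> alpha a = beta a ->
  gradient_curve d Omega f alpha a (Some b) -> gradient_curve d Omega f beta a (Some b) ->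
  exists delta, 0 < delta /\ forall t, a <= t < a + delta -> t < b -> alpha t = beta t.
Proof.
intros Hab Heq Ha Hb.
destruct (gradient_curve_lipschitz _ _ _ _ _ _ Ha) as [M1 [HM1 Hla]].
destruct (gradient_curve_lipschitz _ _ _ _ _ _ Hb) as [M2 [HM2 Hlb]].
destruct Ha as [_ [HOa Hga]]; destruct Hb as [_ [_ Hgb]].
assert (HO : Omega (alpha a) a) by (apply HOa; unfold in_Ico; lra).
destruct (local_data _ _ HO) as [r [lam [K [Hr [Hlam [HK [HOr [Hconc Hest]]]]]]]].
set (q := alpha a) in *.
set (M := M1 + M2 + 1).
(* Up to this time both curves stay within [r / 4] of their common origin. *)
set (delta := r / 4 / M).
assert (HMd : M * delta = r / 4) by (unfold delta, M; field; lra).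
assert (Hd : 0 < delta) by (apply Rdiv_lt_0_compat; [lra|unfold M; lra]).
exists delta; split; auto.
intros t2 Ht2 Ht2b.
assert (Hqa : forall t, a <= t <= t2 -> d q (alpha t) <= r / 4).
{ intros t Ht; assert (H := Hla a t ltac:(unfold in_Ico; lra) ltac:(unfold in_Ico; lra)).
  rewrite Rabs_left1 in H by lra; fold q in H.
  assert (M1 * - (a - t) <= M * delta) by (unfold M; nra); lra. }
assert (Hqb : forall t, a <= t <= t2 -> d q (beta t) <= r / 4).
{ intros t Ht; assert (H := Hlb a t ltac:(unfold in_Ico; lra) ltac:(unfold in_Ico; lra)).
  rewrite Rabs_left1 in H by lra; rewrite <- Heq in H.
  assert (M2 * - (a - t) <= M * delta) by (unfold M; nra); lra. }
set (rho := fun t => d (alpha t) (beta t)).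
assert (Hrho0 : forall t, 0 <= rho t) by (intros; apply (d_nonneg d Hm)).
assert (Hrho1 : forall t, a <= t <= t2 -> rho t <= 1).
{ intros t Ht; assert (H := d_tri d Hm (alpha t) q (beta t)).
  rewrite (d_sym d Hm (alpha t) q) in H.
  assert (H1 := Hqa t Ht); assert (H2 := Hqb t Ht); unfold rho; lra. }
assert (HrhoL : forall s t, a <= s <= t2 -> a <= t <= t2 -> rho t <= rho s + M * Rabs (t - s)).
{ intros s t Hs Ht; unfold rho.
  assert (H1 := d_tri d Hm (alpha t) (alpha s) (beta t)).
  assert (H2 := d_tri d Hm (alpha s) (beta s) (beta t)).
  assert (H3 := Hla t s ltac:(unfold in_Ico; lra) ltac:(unfold in_Ico; lra)).
  assert (H4 := Hlb s t ltac:(unfold in_Ico; lra) ltac:(unfold in_Ico; lra)).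
  rewrite (Rabs_minus_sym s t) in H4; assert (H5 := Rabs_pos (t - s)); unfold M; lra. }
assert (Hfin : rho t2 ^ 2 <= 0).
{ apply (gronwall_dini (fun t => rho t ^ 2) a t2 (2 * lam)); try lra.
  - unfold rho; fold q; rewrite Heq, (proj2 (d_eq0 d Hm _ _) eq_refl); lra.
  - intros t Ht e He; exists (e / (2 * M)).
    split; [apply Rdiv_lt_0_compat; unfold M; lra|].
    intros s Hs Hts.
    assert (H := HrhoL s t ltac:(lra) ltac:(lra)); rewrite Rabs_pos_eq in H by lra.
    assert (H1 := Hrho1 s ltac:(lra)); assert (H2 := Hrho1 t ltac:(lra)).
    assert (H3 := Hrho0 s); assert (H4 := Hrho0 t).
    assert (H5 : M * (t - s) <= e / 2).
    { replace (e / 2) with (M * (e / (2 * M))) by (unfold M; field; lra).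
      apply Rmult_le_compat_l; [unfold M; lra|lra]. }
    nra.
  - intros t Ht e He.
    destruct (Hrho0 t) as [Hpos|Hzero].
    + assert (Hne : alpha t <> beta t).
      { intros H; unfold rho in Hpos; rewrite H, (proj2 (d_eq0 d Hm _ _) eq_refl) in Hpos; lra. }
      assert (HMd' : delta <= r / 4) by (unfold M in HMd; nra).
      destruct (directional_derivatives_sum q a r lam K (alpha t) (beta t) t Hr Hlam HOr
        Hconc Hest (Hqa t ltac:(lra)) (Hqb t ltac:(lra)) Hne)
        as [m [sigma [tau [D1 [D2 [Hsig [Htau [Hm1 [Hm2 [Hsum [HD1 [HD2 HDD]]]]]]]]]]]].
      { rewrite Rabs_pos_eq; lra. }
      (* As [rho t <= 1], the choice of [e1] makes the cross term [4 * eps * rho t * e1] at most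
         [eps * e / 2]; the choice of [d3] below does the same for the term quadratic in [eps]. *)
      set (e1 := Rmin (1 / 2) (e / 8)).
      assert (He1 : 0 < e1) by (apply Rmin_pos; lra).
      assert (He1a := Rmin_l (1 / 2) (e / 8)); assert (He1b := Rmin_r (1 / 2) (e / 8)).
      fold e1 in He1a, He1b.
      destruct (Hga t m sigma D1 ltac:(unfold in_Ico; lra) Hm1 Hsig HD1 e1 He1) as [d1 [Hd1 H1]].
      destruct (Hgb t m tau D2 ltac:(unfold in_Ico; lra) Hm2 Htau HD2 e1 He1) as [d2 [Hd2 H2]].
      set (d3 := e / (2 * (lam + 1) ^ 2)).
      assert (Hlam2 : 0 < (lam + 1) ^ 2) by (apply pow_lt; lra).
      assert (Hd3 : 0 < d3) by (apply Rdiv_lt_0_compat; lra).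
      exists (Rmin (Rmin d1 d2) d3); split; [repeat apply Rmin_pos; auto|].
      intros eps Heps Hte.
      assert (Hmin1 := Rmin_l (Rmin d1 d2) d3); assert (Hmin2 := Rmin_r (Rmin d1 d2) d3).
      assert (Hmin3 := Rmin_l d1 d2); assert (Hmin4 := Rmin_r d1 d2).
      specialize (H1 eps ltac:(lra) ltac:(unfold in_Ico; lra)).
      specialize (H2 eps ltac:(lra) ltac:(unfold in_Ico; lra)).
      assert (Htr := d_tri d Hm (alpha (t + eps)) m (beta (t + eps))).
      rewrite (d_sym d Hm (alpha (t + eps)) m) in Htr.
      rewrite (d_sym d Hm (alpha t) m) in Hsum.
      fold (rho t) in Hsum, HDD; fold (rho (t + eps)) in Htr.
      assert (HDe : eps * (- (lam * rho t)) <= eps * (D1 + D2)) by (apply Rmult_le_compat_l; lra).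
      assert (Hle : rho (t + eps) <= rho t + eps * (lam * rho t + 2 * e1)) by lra.
      assert (Hr1 := Hrho1 t ltac:(lra)).
      set (A := lam * rho t + 2 * e1) in *.
      assert (HA : 0 <= A <= lam + 1) by (unfold A; nra).
      assert (Hsq : rho (t + eps) ^ 2 <= (rho t + eps * A) ^ 2) by (apply pow_incr; auto).
      assert (HA2 : A ^ 2 <= (lam + 1) ^ 2) by (apply pow_incr; lra).
      assert (Heps2 : eps * A ^ 2 <= e / 2).
      { replace (e / 2) with (d3 * (lam + 1) ^ 2) by (unfold d3; field; lra).
        apply Rmult_le_compat; try lra; apply pow2_ge_0. }
      assert (Heps3 : eps * (eps * A ^ 2) <= eps * (e / 2)) by (apply Rmult_le_compat_l; lra).
      assert (Heps4 : rho t * e1 <= e / 8) by nra.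
      assert (Heps5 : eps * (rho t * e1) <= eps * (e / 8)) by (apply Rmult_le_compat_l; lra).
      unfold A in Hsq, Heps3; lra.
    + assert (HM2' : 0 < M ^ 2) by (apply pow_lt; unfold M; lra).
      exists (e / M ^ 2); split; [apply Rdiv_lt_0_compat; lra|].
      intros eps Heps Hte.
      assert (H := HrhoL t (t + eps) ltac:(lra) ltac:(lra)).
      replace (t + eps - t) with eps in H by ring.
      rewrite Rabs_pos_eq in H by lra.
      rewrite <- Hzero in *.
      assert (Hsq : rho (t + eps) ^ 2 <= (M * eps) ^ 2) by (apply pow_incr; split; auto; lra).
      assert (HMe : M ^ 2 * eps <= e).
      { replace e with (M ^ 2 * (e / M ^ 2)) by (field; unfold M; lra).
        apply Rmult_le_compat_l; lra. }
      assert (M ^ 2 * eps * eps <= e * eps) by (apply Rmult_le_compat_r; lra).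
      lra. }
apply (d_eq0 d Hm); fold (rho t2); assert (H := Hrho0 t2); nra.
Qed.

(** Real induction: local uniqueness restarted at [t] extends the agreement to the right, and
    continuity closes it from the left. *)
Lemma gradient_curve_unique alpha beta a b : alpha a = beta a ->
  gradient_curve d Omega f alpha a (Some b) -> gradient_curve d Omega f beta a (Some b) ->
  forall t, a <= t < b -> alpha t = beta t.
Proof.
intros Heq Ha Hb t1 Ht1.
apply (real_induction (fun t => alpha t = beta t) a t1); auto; try lra.
- intros t Ht Hteq.
  destruct (local_uniqueness alpha beta t b ltac:(lra) Hteq) as [delta [Hd H]].
  + eapply gradient_curve_restrict; [|exact Ha]; unfold in_Ico; intros; lra.
  + eapply gradient_curve_restrict; [|exact Hb]; unfold in_Ico; intros; lra.
  + exists delta; split; auto; intros s Hs Hst; apply H; lra.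
- intros t Ht Hlt.
  destruct (gradient_curve_lipschitz _ _ _ _ _ _ Ha) as [M1 [HM1 Hla]].
  destruct (gradient_curve_lipschitz _ _ _ _ _ _ Hb) as [M2 [HM2 Hlb]].
  apply (d_eq0 d Hm), Rle_antisym; [|apply (d_nonneg d Hm)].
  apply Rnot_lt_le; intros Hpos.
  set (e := d (alpha t) (beta t)) in *.
  set (M := M1 + M2 + 1).
  set (s := Rmax a (t - e / 2 / M)).
  assert (HeM : 0 < e / 2 / M) by (repeat apply Rdiv_lt_0_compat; unfold M; lra).
  assert (H1 := Rmax_l a (t - e / 2 / M)); assert (H2 := Rmax_r a (t - e / 2 / M)).
  assert (H3 : s < t) by (apply Rmax_lub_lt; lra).
  fold s in H1, H2.
  assert (H4 := Hla t s ltac:(unfold in_Ico; lra) ltac:(unfold in_Ico; lra)).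
  assert (H5 := Hlb s t ltac:(unfold in_Ico; lra) ltac:(unfold in_Ico; lra)).
  rewrite (Rabs_minus_sym s t) in H5; rewrite Rabs_pos_eq in H4, H5 by lra.
  rewrite <- (Hlt s ltac:(lra)) in H5.
  assert (H6 := d_tri d Hm (alpha t) (alpha s) (beta t)); fold e in H6.
  assert (H7 : M * (t - s) <= e / 2).
  { replace (e / 2) with (M * (e / 2 / M)) by (unfold M; field; lra).
    apply Rmult_le_compat_l; [unfold M; lra|lra]. }
  unfold M in H7; nra.
Qed.

(** Just after each time the curve coincides, by uniqueness, with the constructed one, whose speed
    is at most [2 * L + 2]; Gronwall with rate 0 makes the bound global. A constant common to all
    curves is what allows them to be glued and united. *)
Lemma gradient_curve_speed alpha a b : gradient_curve d Omega f alpha a (Some b) ->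
  forall s t, a <= s -> s <= t -> t < b -> d (alpha s) (alpha t) <= (2 * L + 2) * (t - s).
Proof.
intros Ha s t Hs Hst Ht.
destruct (gradient_curve_lipschitz _ _ _ _ _ _ Ha) as [M [HM Hla]].
cut (d (alpha s) (alpha t) - (2 * L + 2) * (t - s) <= 0); [lra|].
apply (gronwall_dini (fun x => d (alpha s) (alpha x) - (2 * L + 2) * (x - s)) s t 0); try lra.
- rewrite (proj2 (d_eq0 d Hm _ _) eq_refl); lra.
- intros x Hx e He; exists (e / (M + 1)); split; [apply Rdiv_lt_0_compat; lra|].
  intros y Hy Hxy.
  assert (H := Hla y x ltac:(unfold in_Ico; lra) ltac:(unfold in_Ico; lra)).
  rewrite Rabs_left1 in H by lra.
  assert (H1 := d_tri d Hm (alpha s) (alpha y) (alpha x)).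
  assert (H2 : (M + 1) * (x - y) <= e).
  { replace e with ((M + 1) * (e / (M + 1))) by (field; lra).
    apply Rmult_le_compat_l; lra. }
  nra.
- intros x Hx e He.
  assert (HO : Omega (alpha x) x) by (apply (proj1 (proj2 Ha)); unfold in_Ico; lra).
  destruct (local_existence _ _ HO) as [T [u [HT [Hu0 [Hu Hsp]]]]].
  exists T; split; auto; intros eps Heps Hxe.
  assert (Heq : forall y, x <= y < Rmin b (x + T) -> alpha y = u y).
  { assert (H1 := Rmin_l b (x + T)); assert (H2 := Rmin_r b (x + T)).
    apply gradient_curve_unique; auto.
    - eapply gradient_curve_restrict; [|exact Ha]; unfold in_Ico; intros; lra.
    - eapply gradient_curve_restrict; [|exact Hu]; unfold in_Ico; intros; lra. }
  rewrite (Heq (x + eps)).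
  2: { split; [lra|]; apply Rmin_glb_lt; lra. }
  assert (H1 := Hsp x (x + eps) ltac:(lra) ltac:(lra) ltac:(lra)).
  rewrite Hu0 in H1.
  assert (H2 := d_tri d Hm (alpha s) (alpha x) (u (x + eps))).
  nra.
Qed.

(** The gradient condition looks only forward in time, so at [b] it concerns [u] alone. Only the
    Lipschitz bound crosses [b], and it follows by the triangle inequality through [u b]. *)
Lemma gradient_curve_glue alpha u a b c : a < b -> b < c ->
  (forall t, a <= t < b -> d (alpha t) (u b) <= (2 * L + 2) * (b - t)) ->
  gradient_curve d Omega f alpha a (Some b) -> gradient_curve d Omega f u b (Some c) ->
  gradient_curve d Omega f (fun t => if Rlt_dec t b then alpha t else u t) a (Some c).
Proof.
intros Hab Hbc Hq Ha Hu; set (g := fun t => if Rlt_dec t b then alpha t else u t).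
assert (Hgl : forall t, t < b -> g t = alpha t).
{ intros t Ht; unfold g; destruct (Rlt_dec t b); [auto|lra]. }
assert (Hgr : forall t, b <= t -> g t = u t).
{ intros t Ht; unfold g; destruct (Rlt_dec t b); [lra|auto]. }
assert (Hle : forall s t, a <= s -> s <= t -> t < c -> d (g s) (g t) <= (2 * L + 2) * (t - s)).
{ intros s t Hs Hst Ht.
  destruct (Rlt_le_dec t b) as [Htb|Htb].
  - rewrite !Hgl by lra; apply (gradient_curve_speed alpha a b); auto.
  - destruct (Rlt_le_dec s b) as [Hsb|Hsb].
    + rewrite Hgl, Hgr by lra.
      assert (H1 := Hq s ltac:(lra)).
      assert (H2 := gradient_curve_speed u b c Hu b t ltac:(lra) Htb Ht).
      assert (H3 := d_tri d Hm (alpha s) (u b) (u t)); lra.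
    + rewrite !Hgr by lra; apply (gradient_curve_speed u b c); auto. }
destruct Ha as [_ [HOa Hga]]; destruct Hu as [_ [HOu Hgu]].
split; [|split].
- exists (2 * L + 2); intros s t [Hs Hs'] [Ht Ht'].
  destruct (Rle_dec s t) as [Hst|Hst].
  + rewrite Rabs_left1 by lra; replace (- (s - t)) with (t - s) by ring; auto.
  + rewrite (d_sym d Hm), Rabs_pos_eq by lra; apply Hle; lra.
- intros t [Ht Ht']; destruct (Rlt_le_dec t b) as [Htb|Htb].
  + rewrite Hgl by auto; apply HOa; split; auto.
  + rewrite Hgr by auto; apply HOu; split; auto.
- intros t p sigma D [Ht Ht'].
  destruct (Rlt_le_dec t b) as [Htb|Htb].
  + rewrite (Hgl t) by auto; intros Hp Hsig HD e He.
    destruct (Hga t p sigma D (conj Ht Htb) Hp Hsig HD e He) as [delta [Hd H]].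
    exists (Rmin delta (b - t)); split; [apply Rmin_pos; lra|].
    intros eps Heps Hte.
    assert (H1 := Rmin_l delta (b - t)); assert (H2 := Rmin_r delta (b - t)).
    rewrite Hgl by lra; apply H; unfold in_Ico; lra.
  + rewrite (Hgr t) by auto; intros Hp Hsig HD e He.
    destruct (Hgu t p sigma D (conj Htb Ht') Hp Hsig HD e He) as [delta [Hd H]].
    exists delta; split; auto; intros eps Heps [_ Hte].
    rewrite Hgr by lra; apply H; unfold in_Ico; lra.
Qed.

(** * The maximal curve and its behaviour at a finite end *)

Lemma in_Ico_extend a c t : in_Ico a c t ->
  exists t', t < t' /\ forall s, a <= s < t' -> in_Ico a c s.
Proof.
intros [Ht Hc]; destruct c as [c|].
- exists c; split; auto.
- exists (t + 1); split; [lra|]; intros s Hs; split; [lra|auto].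
Qed.

(** The union of all gradient curves from [p], with [b] the supremum of their finite lifetimes.
    Since each condition at given times can be checked on one member of the union, only the
    Lipschitz constant must be uniform, which the speed bound provides. *)
Lemma maximal_gradient_curve a p : Omega p a ->
  exists (b : option R) (alpha : R -> X),
    ER_lt a b /\ gradient_curve d Omega f alpha a b /\ alpha a = p /\
    forall (c : option R) (beta : R -> X), ER_lt a c ->
      gradient_curve d Omega f beta a c -> beta a = p ->
      ER_le c b /\ forall t, in_Ico a c t -> beta t = alpha t.
Proof.
intros HO.
set (E := fun c => a < c /\ exists beta, gradient_curve d Omega f beta a (Some c) /\ beta a = p).
destruct (local_existence p a HO) as [T0 [u0 [HT0 [Hu0 [Hgu0 _]]]]].
assert (HE0 : E (a + T0)) by (split; [lra|exists u0; auto]).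
(* The value at [t] is shared by all curves alive at [t]; if there is none, [p] is a default. *)
assert (Hpick : forall t, { x : X | forall c beta, a <= t < c ->
  gradient_curve d Omega f beta a (Some c) -> beta a = p -> beta t = x }).
{ intros t; apply constructive_indefinite_description.
  destruct (classic (exists c beta, a <= t < c /\
    gradient_curve d Omega f beta a (Some c) /\ beta a = p)) as [[c [beta [Ht [Hb Hbp]]]]|Hno].
  - exists (beta t); intros c' beta' Ht' Hb' Hbp'.
    assert (H1 := Rmin_l c c'); assert (H2 := Rmin_r c c').
    apply (gradient_curve_unique beta' beta a (Rmin c c')); [congruence| | |].
    + eapply gradient_curve_restrict; [|exact Hb']; unfold in_Ico; intros; lra.
    + eapply gradient_curve_restrict; [|exact Hb]; unfold in_Ico; intros; lra.
    + split; [lra|]; apply Rmin_glb_lt; lra.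
  - exists p; intros c beta Ht Hb Hbp; exfalso; apply Hno; exists c, beta; auto. }
set (alpha := fun t => proj1_sig (Hpick t)).
assert (Halpha : forall t c beta, a <= t < c ->
  gradient_curve d Omega f beta a (Some c) -> beta a = p -> beta t = alpha t).
{ intros t; apply (proj2_sig (Hpick t)). }
(* [b] is the supremum of [E], with [None] when [E] is unbounded. *)
assert (Hb : exists b, ER_lt a b /\ (forall c, E c -> ER_le (Some c) b) /\
  (forall t, in_Ico a b t -> exists c, t < c /\ E c)).
{ destruct (classic (bound E)) as [Hbd|Hbd].
  - destruct (completeness E Hbd (ex_intro _ _ HE0)) as [b [Hub Hlub]].
    exists (Some b); split; [|split].
    + assert (H := Hub _ HE0); simpl; lra.
    + intros c Hc; apply Hub; auto.
    + intros t [_ Ht]; apply NNPP; intros Hno.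
      assert (b <= t); [|lra].
      apply Hlub; intros c Hc; apply Rnot_lt_le; intros Htc; apply Hno; exists c; auto.
  - exists None; split; [exact I|split]; [intros; exact I|].
    intros t _; apply NNPP; intros Hno; apply Hbd; exists t; intros c Hc.
    apply Rnot_lt_le; intros Htc; apply Hno; exists c; auto. }
destruct Hb as [b [Hab [Hmax Hcov]]].
assert (Hcover : forall t, in_Ico a b t -> exists c beta, t < c /\
  gradient_curve d Omega f beta a (Some c) /\ forall s, a <= s < c -> beta s = alpha s).
{ intros t Ht; destruct (Hcov t Ht) as [c [Htc [_ [beta [Hbeta Hbp]]]]].
  exists c, beta; repeat split; try apply Hbeta; auto.
  intros s Hs; apply (Halpha s c); auto. }
exists b, alpha; split; [auto|]; split; [split; [|split]|split].
- assert (Hle : forall s t, in_Ico a b s -> in_Ico a b t -> s <= t ->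
    d (alpha s) (alpha t) <= (2 * L + 2) * (t - s)).
  { intros s t Hs Ht Hst; destruct (Hcover t Ht) as [c [beta [Htc [Hbeta Heq]]]].
    destruct Hs as [Has _]; rewrite <- !Heq by lra.
    apply (gradient_curve_speed beta a c); auto. }
  exists (2 * L + 2); intros s t Hs Ht; destruct (Rle_dec s t) as [Hst|Hst].
  + rewrite Rabs_left1 by lra; replace (- (s - t)) with (t - s) by ring; auto.
  + rewrite (d_sym d Hm), Rabs_pos_eq by lra; apply Hle; auto; lra.
- intros t Ht; destruct (Hcover t Ht) as [c [beta [Htc [[_ [HOb _]] Heq]]]].
  destruct Ht as [Hat _]; rewrite <- Heq by lra; apply HOb; split; auto.
- intros t q sigma D Ht; destruct (Hcover t Ht) as [c [beta [Htc [[_ [_ Hg]] Heq]]]].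
  destruct Ht as [Hat _]; rewrite <- (Heq t) by lra; intros Hq Hsig HD e He.
  destruct (Hg t q sigma D (conj Hat Htc) Hq Hsig HD e He) as [delta [Hd H]].
  exists (Rmin delta (c - t)); split; [apply Rmin_pos; lra|].
  intros eps Heps _.
  assert (H1 := Rmin_l delta (c - t)); assert (H2 := Rmin_r delta (c - t)).
  rewrite <- Heq by lra; apply H; unfold in_Ico; lra.
- rewrite <- (Halpha a (a + T0) u0); auto; lra.
- intros c beta Hac Hbeta Hbp.
  assert (Hsub : forall t', a < t' -> (forall s, a <= s < t' -> in_Ico a c s) ->
    gradient_curve d Omega f beta a (Some t') /\ E t').
  { intros t' Hat' Hs.
    assert (Hg : gradient_curve d Omega f beta a (Some t')).
    { eapply gradient_curve_restrict; [|exact Hbeta]; intros s Hs'; apply Hs; exact Hs'. }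
    split; [auto|split; [auto|exists beta; auto]]. }
  split.
  + destruct c as [c|].
    * apply Hmax, Hsub; auto.
    * destruct b as [b|]; [|exact I]; exfalso.
      (* A curve defined for all time would restrict to the lifetime [b + 1], beyond the
         supremum. *)
      destruct (Hsub (b + 1)) as [_ HE]; [simpl in Hab; lra| |].
      { intros s Hs; split; [lra|exact I]. }
      apply Hmax in HE; simpl in HE; lra.
  + intros t Ht; destruct (in_Ico_extend a c t Ht) as [t' [Htt' Hs]].
    destruct Ht as [Hat _].
    apply (Halpha t t'); auto; apply Hsub; auto; lra.
Qed.

(** The speed bound makes the curve Cauchy as time tends to [b]. The rate in the conclusion is the
    one required for gluing. *)
Lemma gradient_curve_endpoint alpha a b : a < b ->
  gradient_curve d Omega f alpha a (Some b) ->
  exists q, forall t, a <= t < b -> d (alpha t) q <= (2 * L + 2) * (b - t).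
Proof.
intros Hab Ha.
assert (Hsp := gradient_curve_speed alpha a b Ha).
set (tn := fun n => b - (b - a) * / (INR n + 1)).
assert (Hinv : forall n, 0 < / (INR n + 1) <= 1).
{ intros n; assert (H := pos_INR n); split; [apply Rinv_0_lt_compat; lra|].
  rewrite <- Rinv_1; apply Rinv_le_contravar; lra. }
assert (Htn : forall n, a <= tn n < b).
{ intros n; assert (H := Hinv n); unfold tn; nra. }
assert (Hnear : forall e, 0 < e -> exists N, forall n, (N <= n)%nat ->
  (2 * L + 2) * (b - tn n) < e).
{ intros e He; destruct (INR_unbounded ((2 * L + 2) * (b - a) / e)) as [N HN].
  exists N; intros n Hn; apply le_INR in Hn; unfold tn.
  assert (Hp := pos_INR n).
  apply Rmult_lt_reg_r with (INR n + 1); [lra|].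
  replace ((2 * L + 2) * (b - (b - (b - a) * / (INR n + 1))) * (INR n + 1))
    with ((2 * L + 2) * (b - a)) by (field; lra).
  replace ((2 * L + 2) * (b - a)) with (e * ((2 * L + 2) * (b - a) / e)) by (field; lra).
  apply Rmult_lt_compat_l; lra. }
assert (Hd : forall s t, a <= s < b -> a <= t < b ->
  d (alpha s) (alpha t) <= (2 * L + 2) * (b - Rmin s t)).
{ intros s t Hs Ht; unfold Rmin; destruct (Rle_dec s t).
  - assert (H := Hsp s t ltac:(lra) ltac:(lra) ltac:(lra)); nra.
  - rewrite (d_sym d Hm); assert (H := Hsp t s ltac:(lra) ltac:(lra) ltac:(lra)); nra. }
destruct (Hcompl (fun n => alpha (tn n))) as [q Hq].
{ intros e He; destruct (Hnear e He) as [N HN]; exists N; intros m n Hm' Hn'.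
  eapply Rle_lt_trans; [apply Hd; apply Htn|].
  unfold Rmin; destruct (Rle_dec (tn m) (tn n)); apply HN; auto. }
exists q; intros t Ht; apply Rnot_lt_le; intros Hlt.
set (e := d (alpha t) q - (2 * L + 2) * (b - t)) in *.
assert (He : 0 < e) by (unfold e; lra).
destruct (Hq (e / 2) ltac:(lra)) as [N1 HN1].
destruct (Hnear (e / 2) ltac:(lra)) as [N2 HN2].
specialize (HN1 (max N1 N2) ltac:(lia)); specialize (HN2 (max N1 N2) ltac:(lia)).
set (s := tn (max N1 N2)) in *.
assert (Hs : a <= s < b) by apply Htn.
assert (H1 := Hd t s Ht Hs).
assert (H2 := d_tri d Hm (alpha t) (alpha s) q).
assert (H3 : (2 * L + 2) * (b - Rmin t s) <= (2 * L + 2) * (b - t) + (2 * L + 2) * (b - s)).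
{ unfold Rmin; destruct (Rle_dec t s); nra. }
unfold e in *; lra.
Qed.

(** The point [(q, b)] reached in the limit is a limit of points of [K], hence lies in [K] and in
    [Omega]. A curve issued from it can then be glued to [alpha]. *)
Lemma extend_of_recurrent alpha a b (K : X -> R -> Prop) : a < b ->
  gradient_curve d Omega f alpha a (Some b) ->
  closed_prod d K -> (forall x t, K x t -> Omega x t) ->
  (forall t0, t0 < b -> exists t, t0 < t < b /\ K (alpha t) t) ->
  exists c beta, b < c /\ gradient_curve d Omega f beta a (Some c) /\ beta a = alpha a.
Proof.
intros Hab Ha HK HKO Hrec.
destruct (gradient_curve_endpoint alpha a b Hab Ha) as [q Hq].
assert (HO : Omega q b).
{ apply HKO, HK; intros r Hr.
  set (e := r / (2 * L + 2)).
  assert (He : 0 < e) by (apply Rdiv_lt_0_compat; lra).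
  assert (Her : (2 * L + 2) * e = r) by (unfold e; field; lra).
  destruct (Hrec (Rmax a (b - e))) as [t [Ht HKt]]; [apply Rmax_lub_lt; lra|].
  assert (H1 := Rmax_l a (b - e)); assert (H2 := Rmax_r a (b - e)).
  exists (alpha t), t; split; [auto|].
  split; [rewrite (d_sym d Hm); assert (H := Hq t ltac:(lra)); nra|].
  rewrite Rabs_left1; nra. }
destruct (local_existence q b HO) as [T [u [HT [Hu0 [Hu _]]]]].
exists (b + T), (fun t => if Rlt_dec t b then alpha t else u t); split; [lra|split].
- apply gradient_curve_glue; auto; try lra; rewrite Hu0; auto.
- destruct (Rlt_dec a b); [auto|lra].
Qed.

End GradientFlow.

Theorem theoremA4 (X : Type) (d : X -> X -> R) (kappa : R)
    (Omega : X -> R -> Prop) (f : R -> X -> R) :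
  is_metric d -> complete d -> length_space d -> CAT kappa d ->
  open_prod d Omega ->
  lipschitz_family d Omega f -> locally_semiconcave d Omega f ->
  forall (a : R) (p : X), Omega p a ->
  exists (b : option R) (alpha : R -> X),
    ER_lt a b /\
    gradient_curve d Omega f alpha a b /\ alpha a = p /\
    (* uniqueness and maximality *)
    (forall (c : option R) (beta : R -> X), ER_lt a c ->
       gradient_curve d Omega f beta a c -> beta a = p ->
       ER_le c b /\ (forall t, in_Ico a c t -> beta t = alpha t)) /\
    (* escape from closed subsets of Omega when b < infinity *)
    (forall b' : R, b = Some b' ->
       forall K : X -> R -> Prop, closed_prod d K -> (forall x t, K x t -> Omega x t) ->
         exists t0, t0 < b' /\ forall t, t0 < t < b' -> ~ K (alpha t) t).
Proof.
intros Hm Hcompl _ Hcat _ [L0 HL0] Hsc a p HO.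
(* The given Lipschitz constant may be negative, so its absolute value is used. *)
assert (Hlip : forall x t y s, Omega x t -> Omega y s ->
  Rabs (f t x - f s y) <= Rabs L0 * (d x y + Rabs (t - s))).
{ intros x t y s Hx Hy; eapply Rle_trans; [apply HL0; auto|].
  apply Rmult_le_compat_r; [|apply RRle_abs].
  assert (H1 := d_nonneg d Hm x y); assert (H2 := Rabs_pos (t - s)); lra. }
destruct (maximal_gradient_curve d kappa Omega f (Rabs L0) Hm Hcompl Hcat Hsc
  (Rabs_pos L0) Hlip a p HO) as [b [alpha [Hab [Ha [Hap Hmax]]]]].
exists b, alpha; repeat split; try apply Ha; auto.
- eapply Hmax; eauto.
- eapply Hmax; eauto.
(* Without escape the curve meets [K] at times arbitrarily close to [b'], so it extends beyond [b'],
   against maximality. *)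
- intros b' -> K HK HKO; apply NNPP; intros Hno.
  destruct (extend_of_recurrent d kappa Omega f (Rabs L0) Hm Hcompl Hcat Hsc
    (Rabs_pos L0) Hlip alpha a b' K Hab Ha HK HKO) as [c [beta [Hbc [Hbeta Hba]]]].
  + intros t0 Ht0; apply NNPP; intros Hno'; apply Hno; exists t0; split; auto.
    intros t Ht HKt; apply Hno'; exists t; auto.
  + destruct (Hmax (Some c) beta) as [Hle _]; simpl in *; try lra; auto; congruence.
Qed.
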